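(* Let $C\in(\mathbb{R}^n)^{\otimes k}$ be a cost tensor that has graphical structure with constant treewidth $\omega$. Then the $\mathsf{MIN}_C$, $\mathsf{AMIN}_C$, and $\mathsf{SMIN}_C$ oracles can be computed in $\mathrm{poly}(n,k)$ time.
   Context: Notation: $[n]=\{1,\dots,n\}$; $\vec{j}=(j_1,\dots,j_k)\in[n]^k$; $\bar{\mathbb{R}}=\mathbb{R}\cup\{-\infty\}$. Runtimes count arithmetic operations; inputs have bit complexity at most $\mathrm{poly}(n,k)$. Oracles. $\mathsf{MIN}_C$: given $p=(p_1,\dots,p_k)\in\mathbb{R}^{n\times k}$, return $\min_{\vec{j}\in[n]^k}C_{\vec{j}}-\sum_{i=1}^k[p_i]_{j_i}$. $\mathsf{AMIN}_C$: given $p\in\mathbb{R}^{n\times k}$ and $\varepsilon>0$, return $\mathsf{MIN}_C(p)$ up to additive error $\varepsilon$. $\mathsf{SMIN}_C$: given $p\in\bar{\mathbb{R}}^{n\times k}$ and $\eta>0$, return $-\frac1\eta\log\sum_{\vec{j}\in[n]^k}\exp(-\eta(C_{\vec{j}}-\sum_{i=1}^k[p_i]_{j_i}))$, with conventions $e^{-\infty}=0$, $\log0=-\infty$. Graphical structure: $C$ has graphical structure with treewidth $\omega$ if there is a collection $\mathcal{S}\subset2^{[k]}$ of subsets of $[k]$ and functions $\{f_S\}_{S\in\mathcal{S}}$ such that $C_{\vec{j}}=\sum_{S\in\mathcal{S}}f_S(\{j_i\}_{i\in S})$ for all $\vec{j}\in[n]^k$, and the graph $G_{\mathcal{S}}$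 has treewidth $\omega$, where $G_{\mathcal{S}}$ has vertex set $[k]$ and edges $\{(i,j): i,j\in S\text{ for some }S\in\mathcal{S}\}$. (Treewidth is the usual graph treewidth: the minimum over junction trees of the maximal bag size minus one.) Standing assumptions: $C$ is input implicitly through the functions $\{f_S\}_{S\in\mathcal{S}}$, and each $f_S$ can be evaluated in polynomial time. *)

(* Defs.v *)
From HB Require Import structures.
From mathcomp Require Import all_boot all_order all_algebra.
From mathcomp Require Import all_classical all_reals all_analysis.

Set Implicit Arguments.
Unset Strict Implicit.
Unset Printing Implicit Defensive.

Import Order.TTheory GRing.Theory Num.Theory.

Local Open Scope ring_scope.

(** * Cost tensors and the three oracles *)

Definition tensor (R : realType) (n k : nat) := {ffun 'I_k -> 'I_n} -> R.

(* The minimum is taken in [\bar R], so that it is total; it is a real number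
   as soon as [0 < n]. *)
Definition MIN (R : realType) (n k : nat) (C : tensor R n k)
    (p : 'M[R]_(n, k)) : \bar R :=
  \big[Order.min/+oo%E]_(j : {ffun 'I_k -> 'I_n})
    (C j - \sum_(i < k) p (j i) i)%:E.

(* [expeR -oo = 0] and [lne 0 = -oo]; the value is [+oo] when every term of the
   sum vanishes. *)
Definition SMIN (R : realType) (n k : nat) (C : tensor R n k)
    (p : 'M[\bar R]_(n, k)) (eta : R) : \bar R :=
  (- ((eta^-1)%:E *
      lne (\sum_(j : {ffun 'I_k -> 'I_n})
             expeR (- (eta%:E * ((C j)%:E - \sum_(i < k) p (j i) i))))))%E.

(** * Treewidth *)

Definition is_tree (T : finType) (e : rel T) : Prop :=
  [/\ (0 < #|T|)%N,
      symmetric e,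
      irreflexive e,
      forall u v, connect e u v
    & forall c : seq T, (2 < size c)%N -> ~ ucycle e c].

Record junction_tree (V : finType) (E : rel V) := JunctionTree {
  jt_node : finType;
  jt_edge : rel jt_node;
  jt_bag : jt_node -> {set V};
  jt_tree : is_tree jt_edge;
  jt_vertex : forall x, exists u, x \in jt_bag u;
  jt_subtree : forall x u v, x \in jt_bag u -> x \in jt_bag v ->
    connect [rel a b | [&& jt_edge a b, x \in jt_bag a & x \in jt_bag b]] u v;
  jt_cover : forall x y, E x y -> exists u, (x \in jt_bag u) && (y \in jt_bag u)
}.

(* The predecessor is harmless on a nonempty vertex set, where some bag is
   nonempty by [jt_vertex]. *)
Definition jt_width (V : finType) (E : rel V) (J : junction_tree E) : nat :=
  (\max_(u : jt_node J) #|jt_bag u|).-1.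

Definition has_treewidth (V : finType) (E : rel V) (w : nat) : Prop :=
  (exists J : junction_tree E, jt_width J = w) /\
  (forall J : junction_tree E, (w <= jt_width J)%N).

(** * Graphical structure *)

(* Only the factors at the members of [scopes] are meaningful. *)
Record factorization (R : realType) (n k : nat) := Factorization {
  scopes : {set {set 'I_k}};
  summand : forall S : {set 'I_k}, {ffun {i : 'I_k | i \in S} -> 'I_n} -> R
}.

Arguments summand {R n k} F S x : rename.

Definition restrict_index (n k : nat) (S : {set 'I_k})
    (j : {ffun 'I_k -> 'I_n}) : {ffun {i : 'I_k | i \in S} -> 'I_n} :=
  [ffun i => j (val i)].

Definition scope_graph (k : nat) (SS : {set {set 'I_k}}) : rel 'I_k :=
  [rel a b | (a != b) && [exists S in SS, (a \in S) && (b \in S)]].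

Definition graphical_structure (R : realType) (n k : nat) (C : tensor R n k)
    (F : factorization R n k) (w : nat) : Prop :=
  (forall j, C j = \sum_(S in scopes F) summand F S (restrict_index S j)) /\
  has_treewidth (scope_graph (scopes F)) w.

(** * Model of computation

    First-order recursive programs over binary trees whose leaves are either
    [VNil] or a real number (LISP with atoms in [R]).  Cells are shared, so
    each construct is a single machine operation; the size of environments is
    bounded by the text of the program.  Real numbers can only be combined by
    the arithmetic operations, compared, and stored; all discrete bookkeeping
    has to be carried out on trees, and is charged as well. *)

Inductive value (R : realType) := VNil | VCons of value R & value R | VReal of R.
Arguments VNil {R}.

Inductive unop := Opp | Exp | Log.
Inductive binop := Add | Mul | Div.

Definition eval_unop (R : realType) (explog : bool) (o : unop) (x : R) :
    option R :=
  match o with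
  | Opp => Some (- x)
  | Exp => if explog then Some (expR x) else None
  | Log => if explog && (0 < x) then Some (ln x) else None
  end.

Definition eval_binop (R : realType) (o : binop) (x y : R) : option R :=
  match o with
  | Add => Some (x + y)
  | Mul => Some (x * y)
  | Div => if y == 0 then None else Some (x / y)
  end.

(* Variables are de Bruijn indices.  The second branch of [EMatch] binds the
   head (index 0) and the tail (index 1) of the scrutinee. *)
Inductive expr :=
| EVar of nat
| ELet of expr & expr
| ENil
| ECons of expr & expr
| EMatch of expr & expr & expr
| EZero
| EOne
| EUnop of unop & expr
| EBinop of binop & expr & expr
| EIfLe of expr & expr & expr & expr
| ECall of nat & expr
| EQuery of expr.

(* The [i]-th function of a program is its [i]-th expression, whose only free
   variable, of index 0, is the argument. *)
Definition program := seq expr.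

(* [evaluates explog query prog env e v c]: in the environment [env], the expression
   [e] evaluates to [v] at cost [c].  The relation [query x v c] says that the
   external oracle answers [v] to [x], at cost [c].  The exponential and the
   logarithm are available only if [explog] holds. *)
Inductive evaluates (R : realType) (explog : bool)
    (query : value R -> value R -> nat -> Prop) (prog : program) :
    seq (value R) -> expr -> value R -> nat -> Prop :=
| EvVar env i v :
    onth env i = Some v ->
    evaluates explog query prog env (EVar i) v 1
| EvLet env e1 e2 v1 v2 c1 c2 :
    evaluates explog query prog env e1 v1 c1 ->
    evaluates explog query prog (v1 :: env) e2 v2 c2 ->
    evaluates explog query prog env (ELet e1 e2) v2 (c1 + c2).+1
| EvNil env :
    evaluates explog query prog env ENil VNil 1
| EvCons env e1 e2 v1 v2 c1 c2 :
    evaluates explog query prog env e1 v1 c1 ->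
    evaluates explog query prog env e2 v2 c2 ->
    evaluates explog query prog env (ECons e1 e2) (VCons v1 v2) (c1 + c2).+1
| EvMatchNil env e e1 e2 v c c1 :
    evaluates explog query prog env e VNil c ->
    evaluates explog query prog env e1 v c1 ->
    evaluates explog query prog env (EMatch e e1 e2) v (c + c1).+1
| EvMatchCons env e e1 e2 h t v c c2 :
    evaluates explog query prog env e (VCons h t) c ->
    evaluates explog query prog [:: h, t & env] e2 v c2 ->
    evaluates explog query prog env (EMatch e e1 e2) v (c + c2).+1
| EvZero env :
    evaluates explog query prog env EZero (VReal 0) 1
| EvOne env :
    evaluates explog query prog env EOne (VReal 1) 1
| EvUnop env o e x z c :
    evaluates explog query prog env e (VReal x) c ->
    eval_unop explog o x = Some z ->
    evaluates explog query prog env (EUnop o e) (VReal z) c.+1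
| EvBinop env o e1 e2 x y z c1 c2 :
    evaluates explog query prog env e1 (VReal x) c1 ->
    evaluates explog query prog env e2 (VReal y) c2 ->
    eval_binop o x y = Some z ->
    evaluates explog query prog env (EBinop o e1 e2) (VReal z) (c1 + c2).+1
| EvIfLe env e1 e2 e3 e4 x y v c1 c2 c :
    evaluates explog query prog env e1 (VReal x) c1 ->
    evaluates explog query prog env e2 (VReal y) c2 ->
    evaluates explog query prog env (if x <= y then e3 else e4) v c ->
    evaluates explog query prog env (EIfLe e1 e2 e3 e4) v (c1 + c2 + c).+1
| EvCall env f body e u v c1 c2 :
    onth prog f = Some body ->
    evaluates explog query prog env e u c1 ->
    evaluates explog query prog [:: u] body v c2 ->
    evaluates explog query prog env (ECall f e) v (c1 + c2).+1
| EvQuery env e u v c1 c2 :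
    evaluates explog query prog env e u c1 ->
    query u v c2 ->
    evaluates explog query prog env (EQuery e) v (c1 + c2).+1.

(** * Encoding of the data *)

Definition enc_seq (R : realType) (s : seq (value R)) : value R :=
  foldr (@VCons R) VNil s.

(* Natural numbers are written in unary. *)
Definition enc_nat (R : realType) (m : nat) : value R := enc_seq (nseq m VNil).

Definition enc_set (R : realType) (k : nat) (S : {set 'I_k}) : value R :=
  enc_seq [seq enc_nat R (i : 'I_k) | i <- enum S].

Definition enc_index (R : realType) (n k : nat) (S : {set 'I_k})
    (x : {ffun {i : 'I_k | i \in S} -> 'I_n}) : value R :=
  enc_seq [seq enc_nat R (x i) | i : {i : 'I_k | i \in S}].

Definition enc_ereal (R : realType) (x : \bar R) : value R :=
  match x with
  | r%:E => VCons (VReal r) VNil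
  | +oo%E => VCons VNil VNil
  | -oo%E => VNil
  end.

(* The list of the columns of a matrix. *)
Definition enc_matrix (R : realType) (X : Type) (enc : X -> value R) (n k : nat)
    (p : 'M[X]_(n, k)) : value R :=
  enc_seq [seq enc_seq [seq enc (p j i) | j <- enum 'I_n] | i <- enum 'I_k].

(* The implicit input: [f_S] can be evaluated at a given point, at cost
   [tau S x]. *)
Inductive factor_query (R : realType) (n k : nat) (F : factorization R n k)
    (tau : forall S : {set 'I_k}, {ffun {i : 'I_k | i \in S} -> 'I_n} -> nat) :
    value R -> value R -> nat -> Prop :=
| FactorQuery (S : {set 'I_k}) (x : {ffun {i : 'I_k | i \in S} -> 'I_n}) :
    S \in scopes F ->
    factor_query F tau (VCons (enc_set R S) (enc_index R x))
      (VReal (summand F S x)) (tau S x).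

(** * Oracles computable in polynomial time *)

(* A problem about a tensor: its further arguments, which of them are
   admissible, how they are written, and the correct answers. *)
Record problem (R : realType) := Problem {
  arg : nat -> nat -> Type;
  arg_ok : forall n k, arg n k -> Prop;
  enc_arg : forall n k, arg n k -> value R;
  answer : forall n k, tensor R n k -> arg n k -> value R -> Prop
}.

Definition MIN_problem (R : realType) : problem R := {|
  arg n k := 'M[R]_(n, k);
  arg_ok n k p := True;
  enc_arg n k p := enc_matrix (@VReal R) p;
  answer n k C p v := exists2 r : R, v = VReal r & r%:E = MIN C p
|}.

Definition AMIN_problem (R : realType) : problem R := {|
  arg n k := ('M[R]_(n, k) * R)%type;
  arg_ok n k a := 0 < a.2;
  enc_arg n k a := VCons (enc_matrix (@VReal R) a.1) (VReal a.2);
  answer n k C a v :=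
    exists2 r : R, v = VReal r & (`|r%:E - MIN C a.1| <= a.2%:E)%E
|}.

Definition SMIN_problem (R : realType) : problem R := {|
  arg n k := ('M[\bar R]_(n, k) * R)%type;
  arg_ok n k a := (forall j i, a.1 j i != +oo%E) /\ 0 < a.2;
  enc_arg n k a := VCons (enc_matrix (@enc_ereal R) a.1) (VReal a.2);
  answer n k C a v := v = enc_ereal (SMIN C a.1 a.2)
|}.

Definition poly_bounded (T : nat -> nat -> nat) : Prop :=
  exists a d : nat, forall n k : nat, (T n k <= a * (n + k).+1 ^ d)%N.

Definition enc_input (R : realType) (P : problem R) (n k : nat)
    (F : factorization R n k) (a : arg P n k) : value R :=
  enc_seq [:: enc_nat R n; enc_nat R k;
              enc_seq [seq enc_set R X | X <- enum (scopes F)];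
              enc_arg a].

(* A single program solves [P] in time polynomial in [n] and [k], uniformly on
   all tensors with graphical structure of treewidth [w] whose factors can be
   evaluated in time [q n k]. *)
Definition poly_time_on_treewidth (R : realType) (explog : bool)
    (P : problem R) (w : nat) (q : nat -> nat -> nat) : Prop :=
  exists (prog : program) (T : nat -> nat -> nat),
    poly_bounded T /\
    forall (n k : nat) (C : tensor R n k) (F : factorization R n k)
        (tau : forall S : {set 'I_k},
           {ffun {i : 'I_k | i \in S} -> 'I_n} -> nat)
        (a : arg P n k),
      (0 < n)%N -> (0 < k)%N ->
      graphical_structure C F w ->
      (forall S x, S \in scopes F -> (tau S x <= q n k)%N) ->
      arg_ok a ->
      exists (v : value R) (c : nat),
        [/\ evaluates explog (factor_query F tau) prog [:: enc_input F a]
              (ECall 0 (EVar 0)) v c,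
            answer C a v
          & (c <= T n k)%N].

(* Main.v *)
From HB Require Import structures.
Require Import Defs.
From mathcomp Require Import all_boot all_order all_algebra.
From mathcomp Require Import all_classical all_reals all_analysis.
From mathcomp Require Import seq fintype finset zify ring.

(** The three oracles are one computation in three guises: a sum, over all
    [j : {ffun 'I_k -> 'I_n}], of a product of local weights, taken in a
    commutative semiring.  For [MIN] (and for [AMIN], of which it is an exact
    answer) the semiring is the tropical one, where addition is the minimum and
    multiplication the addition of reals; for [SMIN] it is the field of reals,
    with the weights [expR (- (eta * f_S))] and [expR (eta * p)].

    Such a sum is computed by eliminating variables, without ever constructing
    a junction tree.  A state is a partial assignment [sigma] together with a
    variable [v] that it leaves free; its value is the sum over the variables of
    the component [D] of [v] in the graph deprived of the domain of [sigma], of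
    the product of all weights that involve [D].  To find it, pick any [u] in
    [D], keep from [sigma] only the variables adjacent to [D], sum over the
    values of [u], and multiply, for each choice, the factors that became
    constant by the values of the components into which [D] falls apart.
    Whichever [u] is picked, the result is the same ([branch_sound],
    [solve_sound]), so that values may be filled in opportunistically: the
    program keeps a table of the states whose assignment has at most [w.+1]
    entries, and at each of [k] rounds it fills in every state that some [u]
    reduces to states already known.

    Treewidth serves only to show that every state that matters ends up known
    ([table_some], [solve_some]).  If the boundary of a connected set [D] lies
    in one bag of a junction tree, then walking along the tree towards the bags
    that meet [D] leads to a bag that contains the boundary and some [u] of [D]
    as well ([advance]): choosing this [u] keeps the assignments of size at most
    [w.+1] and makes the components shrink.  The same walk shows that every
    scope lies in a bag ([scope_in_bag]), so that there are at most
    [k.+1 ^ w.+1] scopes ([card_scopes]).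

    The running time is obtained once and for all, from a small language whose
    only loops are folds over lists.  When all lists that are folded over, and
    the cost of each query, are bounded by [N], a program of this language takes
    a time bounded by a polynomial in [N] that depends on its text only
    ([compile_correct], [cost_poly]).  What is left to prove about the algorithm
    is its result and the lengths of its lists. *)

Set Implicit Arguments.
Unset Strict Implicit.
Unset Printing Implicit Defensive.

Import Order.TTheory GRing.Theory Num.Theory.

(** * A language of bounded loops, and its compilation *)

(** Expressions whose only recursion is the right fold [LFold l i b], where [b]
    sees the value of the tail at index 0 and the item at index 1.  The whole
    environment is itself available as a list: [LDrop i] is its tail, and
    [LApp g a] runs [g] in the environment that [a] evaluates to, which is how
    arguments are passed. *)
Inductive loop :=
| LVar of nat
| LDrop of nat
| LLet of loop & loop
| LNil
| LCons of loop & loop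
| LMatch of loop & loop & loop
| LIf of loop & loop & loop
| LZero
| LOne
| LUnop of unop & loop
| LBinop of binop & loop & loop
| LIfLe of loop & loop & loop & loop
| LFold of loop & loop & loop
| LQuery of loop
| LApp of loop & loop.

Section Semantics.
Context (R : realType) (explog : bool).
Context (query : value R -> value R -> nat -> Prop) (N : nat).
Implicit Types (env : seq (value R)) (v : value R).

Inductive folds (init : value R -> Prop)
    (step : value R -> value R -> value R -> Prop) :
    value R -> value R -> nat -> Prop :=
| FoldsNil v : init v -> folds init step VNil v 0
| FoldsCons x xs a v m :
    folds init step xs a m -> step x a v ->
    folds init step (VCons x xs) v m.+1.

(** Costs do not appear here: bounding by [N] the number of iterations of each
    fold and the cost of each query is enough to recover them from the text of
    the program, see [cost]. *)
Fixpoint runs (h : loop) env v : Prop :=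
  match h with
  | LVar i => onth env i = Some v
  | LDrop i => v = enc_seq (drop i env)
  | LLet a b => exists2 u, runs a env u & runs b (u :: env) v
  | LNil => v = VNil
  | LCons a b => exists u1 u2, [/\ runs a env u1, runs b env u2 & v = VCons u1 u2]
  | LMatch a b c => exists2 u, runs a env u &
      match u with
      | VNil => runs b env v
      | VCons x y => runs c [:: x, y & env] v
      | VReal _ => False
      end
  | LIf a b c => exists2 u, runs a env u &
      match u with
      | VNil => runs c env v
      | VCons _ _ => runs b env v
      | VReal _ => False
      end
  | LZero => v = VReal 0%R
  | LOne => v = VReal 1%R
  | LUnop o a => exists x y,
      [/\ runs a env (VReal x), eval_unop explog o x = Some y & v = VReal y]
  | LBinop o a b => exists x y z,
      [/\ runs a env (VReal x), runs b env (VReal y),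
          eval_binop o x y = Some z & v = VReal z]
  | LIfLe a b c d => exists x y,
      [/\ runs a env (VReal x), runs b env (VReal y) &
          if (x <= y)%R then runs c env v else runs d env v]
  | LFold l i b => exists u m,
      [/\ runs l env u, (m <= N)%N &
          folds (runs i env) (fun x a => runs b [:: a, x & env]) u v m]
  | LQuery a => exists u c, [/\ runs a env u, query u v c & (c <= N)%N]
  | LApp g a => exists2 env', runs a env (enc_seq env') & runs g env' v
  end.

End Semantics.

(** A compiled expression finds its environment, encoded as one list, in the
    variable of index 0; variables are reached by walking down this list, so
    that neither renaming nor closure conversion is ever needed. *)
Fixpoint edrop (i d : nat) : expr :=
  if i is j.+1 then EMatch (EVar d) ENil (edrop j 1) else EVar d.

(** The function of index [f] takes a list paired with an environment.  After
    the two matches the real environment is item, tail, list, environment,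
    argument; hence the indices 1 and 3 in the recursive call, and 4 once its
    result has been bound. *)
Definition fold_body (f : nat) (ei eb : expr) : expr :=
  EMatch (EVar 0) ENil
    (EMatch (EVar 0)
       (ELet (EVar 1) ei)
       (ELet (ECall f (ECons (EVar 1) (EVar 3)))
          (ELet (ECons (EVar 0) (ECons (EVar 1) (EVar 4))) eb))).

(** The second component lists the auxiliary functions, one for each fold; they
    are meant to be placed in the program from the index [b] on. *)
Fixpoint compile (b : nat) (h : loop) : expr * seq expr :=
  match h with
  | LVar i => (EMatch (edrop i 0) ENil (EVar 0), [::])
  | LDrop i => (edrop i 0, [::])
  | LLet a c =>
      let: (ea, fa) := compile b a in
      let: (ec, fc) := compile (b + size fa) c in
      (ELet (ECons ea (EVar 0)) ec, fa ++ fc)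
  | LNil => (ENil, [::])
  | LCons a c =>
      let: (ea, fa) := compile b a in
      let: (ec, fc) := compile (b + size fa) c in
      (ECons ea ec, fa ++ fc)
  | LMatch a c d =>
      let: (ea, fa) := compile b a in
      let: (ec, fc) := compile (b + size fa) c in
      let: (ed, fd) := compile (b + size fa + size fc) d in
      (EMatch ea ec (ELet (ECons (EVar 0) (ECons (EVar 1) (EVar 2))) ed),
       fa ++ fc ++ fd)
  | LIf a c d =>
      let: (ea, fa) := compile b a in
      let: (ec, fc) := compile (b + size fa) c in
      let: (ed, fd) := compile (b + size fa + size fc) d in
      (EMatch ea ed (ELet (EVar 2) ec), fa ++ fc ++ fd)
  | LZero => (EZero, [::])
  | LOne => (EOne, [::])
  | LUnop o a => let: (ea, fa) := compile b a in (EUnop o ea, fa)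
  | LBinop o a c =>
      let: (ea, fa) := compile b a in
      let: (ec, fc) := compile (b + size fa) c in
      (EBinop o ea ec, fa ++ fc)
  | LIfLe a a' c d =>
      let: (ea, fa) := compile b a in
      let: (ea', fa') := compile (b + size fa) a' in
      let: (ec, fc) := compile (b + size fa + size fa') c in
      let: (ed, fd) := compile (b + size fa + size fa' + size fc) d in
      (EIfLe ea ea' ec ed, fa ++ fa' ++ fc ++ fd)
  | LFold l i s =>
      let: (el, fl) := compile b l in
      let: (ei, fi) := compile (b + size fl).+1 i in
      let: (es, fs) := compile ((b + size fl).+1 + size fi) s in
      (ECall (b + size fl) (ECons el (EVar 0)),
       fl ++ fold_body (b + size fl) ei es :: fi ++ fs)
  | LQuery a => let: (ea, fa) := compile b a in (EQuery ea, fa)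
  | LApp g a =>
      let: (ea, fa) := compile b a in
      let: (eg, fg) := compile (b + size fa) g in
      (ELet ea eg, fa ++ fg)
  end.

Fixpoint cost (h : loop) (N : nat) : nat :=
  match h with
  | LVar i => (2 * i + 3)%N
  | LDrop i => (2 * i + 1)%N
  | LLet a b => (cost a N + cost b N + 3)%N
  | LNil | LZero | LOne => 1
  | LCons a b => (cost a N + cost b N + 1)%N
  | LMatch a b c => (cost a N + cost b N + cost c N + 7)%N
  | LIf a b c => (cost a N + cost b N + cost c N + 3)%N
  | LUnop o a => (cost a N + 1)%N
  | LBinop o a b => (cost a N + cost b N + 1)%N
  | LIfLe a b c d => (cost a N + cost b N + cost c N + cost d N + 1)%N
  | LFold l i b => (cost l N + cost i N + N * (cost b N + 16) + 10)%N
  | LQuery a => (cost a N + N + 1)%N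
  | LApp g a => (cost g N + cost a N + 1)%N
  end.

Definition sits (prog : program) (b : nat) (fs : seq expr) : Prop :=
  exists pre post, prog = pre ++ fs ++ post /\ size pre = b.

Lemma sits_cat prog b f1 f2 : sits prog b (f1 ++ f2) ->
  sits prog b f1 /\ sits prog (b + size f1) f2.
Proof.
move=> [pre [post [-> <-]]]; split.
  by exists pre, (f2 ++ post); rewrite -!catA.
by exists (pre ++ f1), post; rewrite size_cat -!catA.
Qed.

Lemma sits_cons prog b f fs : sits prog b (f :: fs) ->
  onth prog b = Some f /\ sits prog b.+1 fs.
Proof.
move=> [pre [post [-> <-]]]; split.
  by rewrite onth_cat ltnn subnn.
by exists (rcons pre f), post; rewrite size_rcons cat_rcons.
Qed.

Ltac ev_var := eapply EvVar; first [reflexivity | eassumption].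

Section Compilation.
Context (R : realType) (explog : bool).
Context (query : value R -> value R -> nat -> Prop) (N : nat).
Implicit Types (env : seq (value R)) (v : value R).

Notation evaluates := (evaluates explog query).
Notation runs := (runs explog query N).

Lemma evaluates_edrop prog env l i d :
  onth env d = Some (enc_seq l) ->
  exists2 c, evaluates prog env (edrop i d) (enc_seq (drop i l)) c
    & (c <= 2 * i + 1)%N.
Proof.
elim: i l d env => [|i IH] l d env Hd /=.
  by exists 1; [rewrite drop0; ev_var | lia].
case: l Hd => [|x l] Hd /=.
  exists (1 + 1).+1; last by lia.
  apply: EvMatchNil; [ev_var | exact: EvNil].
have [|c Hc Hle] := IH l 1 [:: x, enc_seq l & env]; first by [].
exists (1 + c).+1; last by lia.
by apply: EvMatchCons; [ev_var | exact: Hc].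
Qed.

(** By induction on the text of [h]; in the case of a fold, an inner induction
    on its iterations pays at most [cost b N + 16] for each of them. *)
Lemma compile_correct prog h b renv env v :
  sits prog b (compile b h).2 ->
  runs h env v ->
  exists2 c, evaluates prog (enc_seq env :: renv) (compile b h).1 v c & (c <= cost h N)%N.
Proof.
elim: h b renv env v => /=.
- move=> i b renv env v _ Hi.
  have [c Hc Hle] := @evaluates_edrop prog (enc_seq env :: renv) env i 0 erefl.
  have Hdrop : drop i env = v :: drop i.+1 env.
    elim: env i {c Hc Hle} Hi => [|x env IH] [|i] //=; first by case=> ->; rewrite drop0.
    by move=> /IH.
  rewrite Hdrop /= in Hc.
  exists (c + 1).+1; last by lia.
  by apply: EvMatchCons; [exact: Hc | ev_var].
- move=> i b renv env v _ ->.
  exact: evaluates_edrop.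
- move=> a IHa c IHc b renv env v.
  case Ea: (compile b a) => [ea fa]; case Ec: (compile _ c) => [ec fc] /=.
  move=> /sits_cat [Sa Sc] [u Ha Hc].
  have := IHa b renv env u; rewrite Ea => /(_ Sa Ha) [ca Va La].
  have := IHc (b + size fa) (enc_seq env :: renv) (u :: env) v.
  rewrite Ec => /(_ Sc Hc) [cc Vc Lc].
  exists ((ca + 1).+1 + cc).+1; last by lia.
  apply: EvLet; last exact: Vc.
  by apply: EvCons; [exact: Va | ev_var].
- by move=> b renv env v _ ->; exists 1 => //; exact: EvNil.
- move=> a IHa c IHc b renv env v.
  case Ea: (compile b a) => [ea fa]; case Ec: (compile _ c) => [ec fc] /=.
  move=> /sits_cat [Sa Sc] [u1 [u2 [Ha Hc ->]]].
  have := IHa b renv env u1; rewrite Ea => /(_ Sa Ha) [ca Va La].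
  have := IHc (b + size fa) renv env u2; rewrite Ec => /(_ Sc Hc) [cc Vc Lc].
  by exists (ca + cc).+1; [exact: EvCons | lia].
- move=> a IHa c IHc d IHd b renv env v.
  case Ea: (compile b a) => [ea fa]; case Ec: (compile _ c) => [ec fc].
  case Ed: (compile _ d) => [ed fd] /=.
  move=> /sits_cat [Sa] /sits_cat [Sc Sd] [u Ha Hu].
  have := IHa b renv env u; rewrite Ea => /(_ Sa Ha) [ca Va La].
  case: u Va Hu {Ha} => [|x y|//] Va Hu.
    have := IHc (b + size fa) renv env v; rewrite Ec => /(_ Sc Hu) [cc Vc Lc].
    by exists (ca + cc).+1; [exact: EvMatchNil | lia].
  have := IHd (b + size fa + size fc)
    [:: x, y, enc_seq env & renv] [:: x, y & env] v.
  rewrite Ed => /(_ Sd Hu) [cd Vd Ld].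
  exists (ca + ((1 + (1 + 1).+1).+1 + cd).+1).+1; last by lia.
  apply: EvMatchCons; first exact: Va.
  apply: EvLet; last exact: Vd.
  apply: EvCons; first ev_var.
  by apply: EvCons; ev_var.
- move=> a IHa c IHc d IHd b renv env v.
  case Ea: (compile b a) => [ea fa]; case Ec: (compile _ c) => [ec fc].
  case Ed: (compile _ d) => [ed fd] /=.
  move=> /sits_cat [Sa] /sits_cat [Sc Sd] [u Ha Hu].
  have := IHa b renv env u; rewrite Ea => /(_ Sa Ha) [ca Va La].
  case: u Va Hu {Ha} => [|x y|//] Va Hu.
    have := IHd (b + size fa + size fc) renv env v.
    rewrite Ed => /(_ Sd Hu) [cd Vd Ld].
    by exists (ca + cd).+1; [exact: EvMatchNil | lia].
  have := IHc (b + size fa) [:: x, y, enc_seq env & renv] env v.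
  rewrite Ec => /(_ Sc Hu) [cc Vc Lc].
  exists (ca + (1 + cc).+1).+1; last by lia.
  apply: EvMatchCons; first exact: Va.
  by apply: EvLet; [ev_var | exact: Vc].
- by move=> b renv env v _ ->; exists 1 => //; exact: EvZero.
- by move=> b renv env v _ ->; exists 1 => //; exact: EvOne.
- move=> o a IHa b renv env v.
  case Ea: (compile b a) => [ea fa] /= Sa [x [y [Ha Hy ->]]].
  have := IHa b renv env (VReal x); rewrite Ea => /(_ Sa Ha) [ca Va La].
  by exists ca.+1; [exact: EvUnop Va Hy | lia].
- move=> o a IHa c IHc b renv env v.
  case Ea: (compile b a) => [ea fa]; case Ec: (compile _ c) => [ec fc] /=.
  move=> /sits_cat [Sa Sc] [x [y [z [Ha Hc Hz ->]]]].
  have := IHa b renv env (VReal x); rewrite Ea => /(_ Sa Ha) [ca Va La].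
  have := IHc (b + size fa) renv env (VReal y).
  rewrite Ec => /(_ Sc Hc) [cc Vc Lc].
  by exists (ca + cc).+1; [exact: EvBinop Va Vc Hz | lia].
- move=> a IHa a' IHa' c IHc d IHd b renv env v.
  case Ea: (compile b a) => [ea fa]; case Ea': (compile _ a') => [ea' fa'].
  case Ec: (compile _ c) => [ec fc]; case Ed: (compile _ d) => [ed fd] /=.
  move=> /sits_cat [Sa] /sits_cat [Sa'] /sits_cat [Sc Sd] [x [y [Ha Ha' H]]].
  have := IHa b renv env (VReal x); rewrite Ea => /(_ Sa Ha) [ca Va La].
  have := IHa' (b + size fa) renv env (VReal y).
  rewrite Ea' => /(_ Sa' Ha') [ca' Va' La'].
  have [c0 V0 L0] : exists2 c0,
      evaluates prog (enc_seq env :: renv) (if (x <= y)%R then ec else ed) v c0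
      & (c0 <= cost c N + cost d N)%N.
    case: ifP H => _ H.
      have := IHc (b + size fa + size fa') renv env v.
      by rewrite Ec => /(_ Sc H) [cc Vc Lc]; exists cc => //; lia.
    have := IHd (b + size fa + size fa' + size fc) renv env v.
    by rewrite Ed => /(_ Sd H) [cc Vc Lc]; exists cc => //; lia.
  by exists (ca + ca' + c0).+1; [exact: EvIfLe Va Va' V0 | lia].
- move=> l IHl i IHi s IHs b renv env v.
  case El: (compile b l) => [el fl]; case Ei: (compile _ i) => [ei fi].
  case Es: (compile _ s) => [es fs] /=.
  move=> /sits_cat [Sl] /sits_cons [Hf] /sits_cat [Si Ss] [u [m [Hl Hm Hu]]].
  have := IHl b renv env u; rewrite El => /(_ Sl Hl) [cl Vl Ll].
  set f := (b + size fl)%N in Hf Ei Es Ss *.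
  have [c Hc Lc] : exists2 c, evaluates prog [:: VCons u (enc_seq env)]
      (fold_body f ei es) v c & (c <= cost i N + m * (cost s N + 16) + 6)%N.
    elim: Hu => {u v m Hl Hm Vl} [v Hi|x xs acc v m _ [c Hc Lc] Hs].
      have := IHi f.+1 [:: VNil; enc_seq env; VCons VNil (enc_seq env)] env v.
      rewrite Ei => /(_ Si Hi) [ci Vi Li].
      exists (1 + (1 + (1 + ci).+1).+1).+1; last by lia.
      apply: EvMatchCons; first ev_var.
      apply: EvMatchNil; first ev_var.
      by apply: EvLet; first ev_var.
    set E := enc_seq env.
    have := IHs (f.+1 + size fi)%N [:: acc; x; xs;
      VCons x xs; E; VCons (VCons x xs) E] [:: acc, x & env] v.
    rewrite Es => /(_ Ss Hs) [cs Vs Ls].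
    exists (1 + (1 + (((1 + 1).+1 + c).+1 + ((1 + (1 + 1).+1).+1 + cs).+1).+1).+1).+1;
      last by lia.
    apply: EvMatchCons; first ev_var.
    apply: EvMatchCons; first ev_var.
    apply: EvLet.
      apply: EvCall; first exact: Hf.
        by apply: EvCons; ev_var.
      exact: Hc.
    apply: EvLet; last exact: Vs.
    apply: EvCons; first ev_var.
    by apply: EvCons; ev_var.
  exists ((cl + 1).+1 + c).+1; last first.
    have : (m * (cost s N + 16) <= N * (cost s N + 16))%N by rewrite leq_mul2r Hm orbT.
    by lia.
  apply: EvCall; [exact: Hf | | exact: Hc].
  by apply: EvCons; [exact: Vl | ev_var].
- move=> a IHa b renv env v.
  case Ea: (compile b a) => [ea fa] /= Sa [u [c [Ha Hq Lc]]].
  have := IHa b renv env u; rewrite Ea => /(_ Sa Ha) [ca Va La].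
  by exists (ca + c).+1; [exact: EvQuery Va Hq | lia].
- move=> g IHg a IHa b renv env v.
  case Ea: (compile b a) => [ea fa]; case Eg: (compile _ g) => [eg fg] /=.
  move=> /sits_cat [Sa Sg] [env' Ha Hg].
  have := IHa b renv env (enc_seq env'); rewrite Ea => /(_ Sa Ha) [ca Va La].
  have := IHg (b + size fa) (enc_seq env :: renv) env' v.
  rewrite Eg => /(_ Sg Hg) [cg Vg Lg].
  by exists (ca + cg).+1; [exact: EvLet Va Vg | lia].
Qed.

End Compilation.

Definition program_of (h : loop) : program :=
  let: (e, fs) := compile 1 h in ELet (ECons (EVar 0) ENil) e :: fs.

Lemma program_of_correct (R : realType) explog
    (query : value R -> value R -> nat -> Prop) N h u v :
  runs explog query N h [:: u] v ->
  exists2 c, evaluates explog query (program_of h) [:: u] (ECall 0 (EVar 0)) v c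
    & (c <= cost h N + 6)%N.
Proof.
move=> Hv; have := @compile_correct R explog query N (program_of h) h 1
  [:: u] [:: u] v.
rewrite /program_of; case: (compile 1 h) => e fs /= /(_ _ Hv) [|c Vc Lc].
  by exists [:: ELet (ECons (EVar 0) ENil) e], [::]; rewrite cats0.
exists (1 + ((1 + 1).+1 + c).+1).+1; last by lia.
apply: EvCall => //; first ev_var.
apply: EvLet; last exact: Vc.
by apply: EvCons; [ev_var | exact: EvNil].
Qed.

Lemma poly_bounded_const m : poly_bounded (fun _ _ => m).
Proof. by exists m, 0 => n k; rewrite muln1. Qed.

Lemma poly_bounded_fst : poly_bounded (fun n _ => n).
Proof. by exists 1, 1 => n k; lia. Qed.

Lemma poly_bounded_snd : poly_bounded (fun _ k => k).
Proof. by exists 1, 1 => n k; lia. Qed.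

Lemma poly_boundedD f g : poly_bounded f -> poly_bounded g ->
  poly_bounded (fun n k => f n k + g n k)%N.
Proof.
move=> [a [d Hf]] [b [e Hg]]; exists (a + b)%N, (maxn d e) => n k.
rewrite mulnDl leq_add //.
  by apply: leq_trans (Hf n k) _; rewrite leq_mul // leq_pexp2l // leq_maxl.
by apply: leq_trans (Hg n k) _; rewrite leq_mul // leq_pexp2l // leq_maxr.
Qed.

Lemma poly_boundedM f g : poly_bounded f -> poly_bounded g ->
  poly_bounded (fun n k => f n k * g n k)%N.
Proof.
move=> [a [d Hf]] [b [e Hg]]; exists (a * b)%N, (d + e)%N => n k.
by rewrite expnD mulnACA leq_mul.
Qed.

Lemma poly_bounded_exp f e : poly_bounded f -> poly_bounded (fun n k => f n k ^ e)%N.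
Proof.
move=> Hf; elim: e => [|e IH]; first exact: poly_bounded_const.
by have [a [d H]] := poly_boundedM Hf IH; exists a, d => n k; rewrite expnS.
Qed.

(** The cost of a fixed program is built from constants and [N] by finitely many
    additions and multiplications. *)
Lemma cost_poly h f : poly_bounded f -> poly_bounded (fun n k => cost h (f n k)).
Proof.
move=> Hf; elim: h => /= *;
  repeat match goal with
  | |- poly_bounded f => exact: Hf
  | H : poly_bounded ?u |- poly_bounded ?u => exact: H
  | |- poly_bounded (fun n k => addn (@?u n k) (@?v n k)) => apply: (@poly_boundedD u v)
  | |- poly_bounded (fun n k => muln (@?u n k) (@?v n k)) => apply: (@poly_boundedM u v)
  | |- poly_bounded (fun n k => f n k) => exact: Hf
  | |- poly_bounded _ => exact: poly_bounded_const
  end.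
Qed.

Arguments runs : simpl never.

(** * Programming with folds *)
Definition enc_list (R : realType) (X : Type) (enc : X -> value R) (s : seq X) :
  value R := enc_seq (map enc s).

(** False is [VNil], so that [LIf] can test truth values. *)
Definition enc_bool (R : realType) (b : bool) : value R := enc_nat R b.

Definition enc_pair (R : realType) (X Y : Type) (encX : X -> value R)
    (encY : Y -> value R) (p : X * Y) : value R :=
  VCons (encX p.1) (encY p.2).

Definition enc_option (R : realType) (X : Type) (enc : X -> value R)
    (o : option X) : value R :=
  if o is Some x then VCons (enc x) VNil else VNil.

Definition l_true := LCons LNil LNil.
Definition l_and a b := LIf a b LNil.
Definition l_or a b := LIf a l_true b.
Definition l_not a := LIf a LNil l_true.
Definition l_head a := LMatch a LNil (LVar 0).
Definition l_tail a := LMatch a LNil (LVar 1).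
Definition l_some a := LCons a LNil.

(** The callee sees its arguments first, followed by the environment of the
    caller without its [m] innermost entries. *)
Definition l_call (m : nat) (g : loop) (args : seq loop) : loop :=
  LApp g (foldr LCons (LDrop m) args).

Definition l_all l c := LFold l l_true (LIf c (LVar 0) LNil).
Definition l_any l c := LFold l LNil (LIf c l_true (LVar 0)).
Definition l_map l b := LFold l LNil (LCons b (LVar 0)).
Definition l_filter l c := LFold l LNil (LIf c (LCons (LVar 1) (LVar 0)) (LVar 0)).
Definition l_pairs l1 l2 b :=
  LFold l1 LNil (LFold l2 (LVar 0) (LCons b (LVar 0))).

(** The rules below mirror the constructions one by one: running a program is
    proved by following its text. *)
Section Rules.
Context (R : realType) (explog : bool).
Context (query : value R -> value R -> nat -> Prop) (N : nat).
Implicit Types (env : seq (value R)) (v : value R).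

Notation runs := (runs explog query N).

Lemma run_let a b env u v : runs a env u -> runs b (u :: env) v ->
  runs (LLet a b) env v.
Proof. by exists u. Qed.

Lemma run_cons a b env u v : runs a env u -> runs b env v ->
  runs (LCons a b) env (VCons u v).
Proof. by exists u, v. Qed.

Lemma run_true env : runs l_true env (enc_bool R true).
Proof. by exists VNil, VNil. Qed.

Lemma run_if a b c env (t : bool) v : runs a env (enc_bool R t) ->
  (t -> runs b env v) -> (~~ t -> runs c env v) -> runs (LIf a b c) env v.
Proof. by case: t => Ha Hb Hc; eexists; [exact: Ha| |exact: Ha|]; [exact: Hb|exact: Hc]. Qed.

Lemma run_if_eq a b c env (t : bool) v1 v2 : runs a env (enc_bool R t) ->
  runs b env v1 -> runs c env v2 -> runs (LIf a b c) env (if t then v1 else v2).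
Proof. by move=> Ha Hb Hc; apply: run_if Ha _ _ => // [->|/negbTE->]. Qed.

Lemma run_and a b env s t : runs a env (enc_bool R s) -> runs b env (enc_bool R t) ->
  runs (l_and a b) env (enc_bool R (s && t)).
Proof. by case: s => Ha Hb; apply: run_if Ha _ _. Qed.

Lemma run_or a b env s t : runs a env (enc_bool R s) -> runs b env (enc_bool R t) ->
  runs (l_or a b) env (enc_bool R (s || t)).
Proof. by case: s => Ha Hb; apply: run_if Ha _ _ => // _; exact: run_true. Qed.

Lemma run_not a env s : runs a env (enc_bool R s) ->
  runs (l_not a) env (enc_bool R (~~ s)).
Proof. by case: s => Ha; apply: run_if Ha _ _ => // _; exact: run_true. Qed.

Lemma run_head a env u v : runs a env (VCons u v) -> runs (l_head a) env u.
Proof. by move=> Ha; exists (VCons u v). Qed.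

Lemma run_tail a env u v : runs a env (VCons u v) -> runs (l_tail a) env v.
Proof. by move=> Ha; exists (VCons u v). Qed.

Lemma run_call m g args env vals v :
  size args = size vals ->
  (forall i, (i < size args)%N -> runs (nth LNil args i) env (nth VNil vals i)) ->
  runs g (vals ++ drop m env) v -> runs (l_call m g args) env v.
Proof.
move=> Hs Hargs Hg; exists (vals ++ drop m env) => //.
elim: args vals Hs Hargs {Hg} => [|a args IH] [|u vals] //= [Hs] Hargs.
apply: run_cons; first exact: (Hargs 0).
by apply: IH => // i Hi; exact: (Hargs i.+1).
Qed.

Lemma run_call1 m g a env u v :
  runs a env u -> runs g (u :: drop m env) v -> runs (l_call m g [:: a]) env v.
Proof.
move=> Ha; apply: (run_call (vals := [:: u])) => //.
by case.
Qed.

Lemma run_call2 m g a b env u1 u2 v :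
  runs a env u1 -> runs b env u2 ->
  runs g [:: u1, u2 & drop m env] v -> runs (l_call m g [:: a; b]) env v.
Proof.
move=> Ha Hb; apply: (run_call (vals := [:: u1; u2])) => //.
by do 2?[case=> //].
Qed.

Lemma run_call3 m g a b c env u1 u2 u3 v :
  runs a env u1 -> runs b env u2 -> runs c env u3 ->
  runs g [:: u1, u2, u3 & drop m env] v -> runs (l_call m g [:: a; b; c]) env v.
Proof.
move=> Ha Hb Hc; apply: (run_call (vals := [:: u1; u2; u3])) => //.
by do 3?[case=> //].
Qed.

Lemma run_call4 m g a b c d env u1 u2 u3 u4 v :
  runs a env u1 -> runs b env u2 -> runs c env u3 -> runs d env u4 ->
  runs g [:: u1, u2, u3, u4 & drop m env] v ->
  runs (l_call m g [:: a; b; c; d]) env v.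
Proof.
move=> Ha Hb Hc Hd; apply: (run_call (vals := [:: u1; u2; u3; u4])) => //.
by do 4?[case=> //].
Qed.

Section Folds.
Context (X : eqType) (enc : X -> value R).

(** The encodings turn a fold of the language into a [foldr] on typed data. *)
Lemma run_fold A (encA : A -> value R) f a0 (s : seq X) l i b env :
  runs l env (enc_list enc s) -> (size s <= N)%N ->
  runs i env (encA a0) ->
  (forall x a, x \in s -> runs b [:: encA a, enc x & env] (encA (f x a))) ->
  runs (LFold l i b) env (encA (foldr f a0 s)).
Proof.
move=> Hl Hs Hi Hb; exists (enc_list enc s), (size s); split=> //.
elim: s {Hl Hs} Hb => [|x s IH] Hb /=; first exact: FoldsNil.
apply: FoldsCons; last by apply: Hb; rewrite mem_head.
by apply: IH => y a ys; apply: Hb; rewrite inE ys orbT.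
Qed.

Lemma run_all (p : pred X) (s : seq X) l c env :
  runs l env (enc_list enc s) -> (size s <= N)%N ->
  (forall x v, x \in s -> runs c [:: v, enc x & env] (enc_bool R (p x))) ->
  runs (l_all l c) env (enc_bool R (all p s)).
Proof.
move=> Hl Hs Hc.
have -> : all p s = foldr (fun x a => p x && a) true s by elim: s {Hl Hs Hc} => //= x s ->.
apply: (run_fold (encA := enc_bool R)) Hl Hs (run_true env) _ => x a xs.
by apply: run_if (Hc _ _ xs) _ _ => [->|/negbTE->].
Qed.

Lemma run_any (p : pred X) (s : seq X) l c env :
  runs l env (enc_list enc s) -> (size s <= N)%N ->
  (forall x v, x \in s -> runs c [:: v, enc x & env] (enc_bool R (p x))) ->
  runs (l_any l c) env (enc_bool R (has p s)).
Proof.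
move=> Hl Hs Hc.
have -> : has p s = foldr (fun x a => p x || a) false s by elim: s {Hl Hs Hc} => //= x s ->.
apply: (run_fold (encA := enc_bool R)) Hl Hs _ _ => // x a xs.
by apply: run_if (Hc _ _ xs) _ _ => [->|/negbTE->] //; exact: run_true.
Qed.

Lemma run_map Y (encY : Y -> value R) f (s : seq X) l b env :
  runs l env (enc_list enc s) -> (size s <= N)%N ->
  (forall x v, x \in s -> runs b [:: v, enc x & env] (encY (f x))) ->
  runs (l_map l b) env (enc_list encY (map f s)).
Proof.
move=> Hl Hs Hb; have -> : map f s = foldr (fun x a => f x :: a) [::] s by [].
apply: (run_fold (encA := enc_list encY)) Hl Hs _ _ => // x a xs.
by apply: run_cons => //; apply: Hb.
Qed.

Lemma run_filter (p : pred X) (s : seq X) l c env :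
  runs l env (enc_list enc s) -> (size s <= N)%N ->
  (forall x v, x \in s -> runs c [:: v, enc x & env] (enc_bool R (p x))) ->
  runs (l_filter l c) env (enc_list enc (filter p s)).
Proof.
move=> Hl Hs Hc.
have -> : filter p s = foldr (fun x a => if p x then x :: a else a) [::] s by [].
apply: (run_fold (encA := enc_list enc)) Hl Hs _ _ => // x a xs.
by apply: run_if (Hc _ _ xs) _ _ => [->|/negbTE->] //; exact: run_cons.
Qed.

End Folds.

Lemma run_pairs (X : eqType) (enc : X -> value R) (Y : eqType)
    (encY : Y -> value R) Z (encZ : Z -> value R) f (s : seq X) (t : seq Y) l1 l2 b env :
  runs l1 env (enc_list enc s) -> (size s <= N)%N ->
  (forall v x, runs l2 [:: v, x & env] (enc_list encY t)) -> (size t <= N)%N ->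
  (forall x y v v', x \in s -> y \in t ->
     runs b [:: v', encY y, v, enc x & env] (encZ (f x y))) ->
  runs (l_pairs l1 l2 b) env (enc_list encZ [seq f x y | x <- s, y <- t]).
Proof.
move=> Hl1 Hs Hl2 Ht Hb.
have -> : [seq f x y | x <- s, y <- t] =
    foldr (fun x a => foldr (fun y a => f x y :: a) a t) [::] s.
  elim: s {Hl1 Hs Hb} => //= x s ->.
  by elim: t {Hl2 Ht} (foldr _ _ s) => //= y t IH a; rewrite -IH.
apply: (run_fold (enc := enc) (encA := enc_list encZ)) Hl1 Hs _ _ => // x a xs.
apply: (run_fold (enc := encY) (encA := enc_list encZ)) (Hl2 _ _) Ht _ _ => // y a' yt.
by apply: run_cons => //; apply: Hb.
Qed.

End Rules.

(** Arguments are listed from the index 0 on.  Those of [l_drop] and [l_nth] are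
    a number in unary and a list; dropping a unary number from another one is
    also the truncated subtraction, from which equality is tested. *)
Definition l_drop := LFold (LVar 0) (LVar 1) (LMatch (LVar 0) LNil (LVar 1)).
Definition l_nth := LMatch l_drop LNil (LVar 0).
Definition l_eqn :=
  LIf l_drop LNil (LIf (l_call 0 l_drop [:: LVar 1; LVar 0]) LNil l_true).
Definition l_mem := l_any (LVar 1) (l_call 0 l_eqn [:: LVar 1; LVar 2]).
Definition l_inter := l_any (LVar 0) (l_call 0 l_mem [:: LVar 1; LVar 3]).
Definition l_subset := l_all (LVar 0) (l_call 0 l_mem [:: LVar 1; LVar 3]).

Section Library.
Context (R : realType) (explog : bool).
Context (query : value R -> value R -> nat -> Prop) (N : nat).
Implicit Types (env : seq (value R)) (v : value R).

Notation runs := (runs explog query N).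

Lemma enc_natE m : enc_nat R m = enc_list (fun _ : unit => VNil) (nseq m tt).
Proof. by rewrite /enc_list map_nseq. Qed.

(** A fold over a number written in unary is a loop that runs as many times. *)
Lemma run_iter_seq (u : nat -> value R) m l i b env :
  runs l env (enc_nat R m) -> (m <= N)%N -> runs i env (u 0) ->
  (forall r, (r < m)%N -> runs b [:: u r, VNil & env] (u r.+1)) ->
  runs (LFold l i b) env (u m).
Proof.
move=> Hl Hm Hi Hb; exists (enc_nat R m), m; split=> //.
elim: m {Hl Hm} Hb => [|m IH] Hb; first exact: FoldsNil.
apply: FoldsCons; last exact: Hb.
by apply: IH => r rm; apply: Hb; exact: ltnW.
Qed.

Lemma run_iter A (encA : A -> value R) f a0 m l i b env :
  runs l env (enc_nat R m) -> (m <= N)%N -> runs i env (encA a0) ->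
  (forall a, runs b [:: encA a, VNil & env] (encA (f a))) ->
  runs (LFold l i b) env (encA (iter m f a0)).
Proof.
move=> Hl Hm Hi Hb.
exact: (run_iter_seq (u := fun r => encA (iter r f a0))).
Qed.

Lemma run_drop X (enc : X -> value R) m (s : seq X) env : (m <= N)%N ->
  runs l_drop [:: enc_nat R m, enc_list enc s & env] (enc_list enc (drop m s)).
Proof.
move=> Hm; have -> : drop m s = iter m behead s.
  elim: m {Hm} => [|m IH]; first by rewrite drop0.
  by rewrite iterS -IH -drop1 drop_drop.
apply: (run_iter (encA := enc_list enc)) => // a.
by exists (enc_list enc a) => //; case: a.
Qed.

Lemma run_nth X (enc : X -> value R) x0 m (s : seq X) env : (m <= N)%N ->
  (m < size s)%N ->
  runs l_nth [:: enc_nat R m, enc_list enc s & env] (enc (nth x0 s m)).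
Proof.
move=> Hm Hs; exists (enc_list enc (drop m s)); first exact: run_drop.
by rewrite (drop_nth x0) //.
Qed.

Lemma run_drop_nat m p env : (m <= N)%N ->
  runs l_drop [:: enc_nat R m, enc_nat R p & env] (enc_nat R (p - m)).
Proof.
move=> Hm; have := run_drop (fun _ : unit => @VNil R) (nseq p tt) env Hm.
by rewrite drop_nseq -!enc_natE.
Qed.

Lemma run_eqn m p env : (m <= N)%N -> (p <= N)%N ->
  runs l_eqn [:: enc_nat R m, enc_nat R p & env] (enc_bool R (m == p)).
Proof.
move=> Hm Hp; exists (enc_nat R (p - m)); first exact: run_drop_nat.
case: ltngtP => [lt_mp|lt_pm|->]; last 2 first.
- rewrite (eqP (ltnW lt_pm)); exists (enc_nat R (m - p)).
    by apply: (run_call2 (u1 := enc_nat R p) (u2 := enc_nat R m)) => //; exact: run_drop_nat.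
  by rewrite -(prednK (_ : 0 < m - p)%N) ?subn_gt0.
- rewrite subnn; exists (enc_nat R (p - p)).
    by apply: (run_call2 (u1 := enc_nat R p) (u2 := enc_nat R p)) => //; exact: run_drop_nat.
  by rewrite subnn; exact: run_true.
by rewrite -(prednK (_ : 0 < p - m)%N) ?subn_gt0.
Qed.

Section Ordinals.
Context (k : nat) (le_kN : (k <= N)%N).

Definition enc_ord (i : 'I_k) : value R := enc_nat R i.

Lemma run_eq_ord (i j : 'I_k) env :
  runs l_eqn [:: enc_ord i, enc_ord j & env] (enc_bool R (i == j)).
Proof. by apply: run_eqn; apply: leq_trans le_kN; apply: ltnW. Qed.

Lemma run_mem (i : 'I_k) (s : seq 'I_k) env : (size s <= N)%N ->
  runs l_mem [:: enc_ord i, enc_list enc_ord s & env] (enc_bool R (i \in s)).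
Proof.
move=> Hs; rewrite -has_pred1.
apply: (run_any (enc := enc_ord)) => // x v _.
by apply: (run_call2 (u1 := enc_ord x) (u2 := enc_ord i)) => //; exact: run_eq_ord.
Qed.

Lemma enc_setE (S : {set 'I_k}) : enc_set R S = enc_list enc_ord (enum S).
Proof. by []. Qed.

Lemma size_enum_le (S : {set 'I_k}) : (size (enum S) <= N)%N.
Proof. by rewrite -cardE (leq_trans _ le_kN) // (leq_trans (max_card _)) ?card_ord. Qed.

Lemma run_mem_set (i : 'I_k) (S : {set 'I_k}) env :
  runs l_mem [:: enc_ord i, enc_set R S & env] (enc_bool R (i \in S)).
Proof. by rewrite -mem_enum; apply: run_mem; exact: size_enum_le. Qed.

Lemma run_inter (S X : {set 'I_k}) env :
  runs l_inter [:: enc_set R S, enc_set R X & env]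
    (enc_bool R [exists j in S, j \in X]).
Proof.
have -> : [exists j in S, j \in X] = has [in X] (enum S).
  apply/exists_inP/hasP => [[j jS jX]|[j]]; first by exists j; rewrite ?mem_enum.
  by rewrite mem_enum => jS jX; exists j.
apply: (run_any (enc := enc_ord)) => //; first exact: size_enum_le.
move=> j v _.
by apply: (run_call2 (u1 := enc_ord j) (u2 := enc_set R X)) => //; exact: run_mem_set.
Qed.

Lemma run_subset (S X : {set 'I_k}) env :
  runs l_subset [:: enc_set R S, enc_set R X & env] (enc_bool R (S \subset X)).
Proof.
have -> : (S \subset X) = all [in X] (enum S).
  by apply/subsetP/allP => H j; [rewrite mem_enum | rewrite -mem_enum]; exact: H.
apply: (run_all (enc := enc_ord)) => //; first exact: size_enum_le.
move=> j v _.
by apply: (run_call2 (u1 := enc_ord j) (u2 := enc_set R X)) => //; exact: run_mem_set.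
Qed.

(** Sets of variables are always obtained by filtering the increasing list of
    all of them, so that each set has one encoding, that of [enc_set]. *)
Lemma run_filter_set (p : pred 'I_k) l c env :
  runs l env (enc_list enc_ord (enum 'I_k)) ->
  (forall i v, runs c [:: v, enc_ord i & env] (enc_bool R (p i))) ->
  runs (l_filter l c) env (enc_set R [set i | p i]).
Proof.
move=> Hl Hc; rewrite enc_setE.
have -> : enum [set i | p i] = filter p (enum 'I_k).
  by rewrite /enum_mem -filter_predI; apply: eq_filter => i; rewrite !inE andbT.
by apply: run_filter Hl _ _ => //; rewrite size_enum_ord.
Qed.

End Ordinals.
End Library.

(** * Partial sums over assignments *)
Section Marginals.
Local Open Scope ring_scope.
Context (V A : finType) (K : comPzSemiRingType).
Implicit Types (x y : {ffun V -> A}) (W U : {set V}) (phi psi : {ffun V -> A} -> K).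

Definition upd y (u : V) (a : A) : {ffun V -> A} :=
  [ffun i => if i == u then a else y i].

Definition agree_off W x y := [forall i, (i \notin W) ==> (x i == y i)].

(** Summing out the variables of [W] and reading the others from [y]; keeping
    [y] total avoids any type of partial assignments. *)
Definition marg W phi y : K := \sum_(x | agree_off W x y) phi x.

Definition depends phi W := forall x y, {in W, x =1 y} -> phi x = phi y.

Lemma agree_offP W x y : reflect (forall i, i \notin W -> x i = y i) (agree_off W x y).
Proof.
apply: (iffP forallP) => H i; first by move=> iW; apply/eqP; exact: (implyP (H i)).
by apply/implyP => iW; rewrite H.
Qed.

Lemma marg0 phi y : marg set0 phi y = phi y.
Proof.
rewrite /marg (big_pred1 y) // => x; apply/agree_offP/eqP => [H|-> //].
by apply/ffunP => i; rewrite H ?inE.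
Qed.

Lemma margT phi y : marg setT phi y = \sum_x phi x.
Proof. by apply: eq_bigl => x; apply/agree_offP => i; rewrite inE. Qed.

(** Sorting the summands by the value they give to [u]. *)
Lemma marg_peel W u phi y : u \in W ->
  marg W phi y = \sum_a marg (W :\ u) phi (upd y u a).
Proof.
move=> uW; rewrite /marg (partition_big (fun x : {ffun V -> A} => x u) xpredT) //=.
apply: eq_bigr => a _; apply: eq_bigl => x; apply/andP/agree_offP.
  move=> [/agree_offP H /eqP xu] i; rewrite ffunE !inE negb_and negbK.
  by case: eqP => [-> _|_ /= iW] //; exact: H.
move=> H; split; last by rewrite H ?ffunE ?eqxx // !inE eqxx.
apply/agree_offP => i iW; rewrite H; last by rewrite !inE (negbTE iW) andbF.
by rewrite ffunE; case: eqP iW => // ->; rewrite uW.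
Qed.

Lemma card_ind (P : {set V} -> Prop) : P set0 ->
  (forall W u, u \in W -> P (W :\ u) -> P W) -> forall W, P W.
Proof.
move=> P0 PS W; elim: #|W| {-2}W (erefl #|W|) => [|m IH] {}W cW.
  by rewrite (cards0_eq cW).
have [u uW] : exists u, u \in W by apply/card_gt0P; rewrite cW.
by apply: (PS W u uW); apply: IH; move: cW; rewrite (cardsD1 u) uW => -[].
Qed.

Lemma marg_local W B phi y y' : depends phi B -> {in B :\: W, y =1 y'} ->
  marg W phi y = marg W phi y'.
Proof.
move=> Hphi; elim/card_ind: W y y' => [|W u uW IH] y y' Hy.
  by rewrite !marg0; apply: Hphi => i iB; apply: Hy; rewrite !inE.
rewrite !(marg_peel _ _ uW); apply: eq_bigr => a _; apply: IH => i.
rewrite !inE !ffunE negb_and negbK; case: eqP => //= _ H.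
by apply: Hy; rewrite inE.
Qed.

(** Fubini, in the case where the summand is a product of two functions that do
    not see each other's variables. *)
Lemma marg_split U W B C phi psi y :
  [disjoint U & W] -> depends phi B -> [disjoint B & W] ->
  depends psi C -> [disjoint C & U] ->
  marg (U :|: W) (fun x => phi x * psi x) y = marg U phi y * marg W psi y.
Proof.
move=> dUW Hphi dBW Hpsi; elim/card_ind: U y dUW => [|U u uU IH] y dUW dCU.
  rewrite set0U marg0 /marg big_distrr /=; apply: eq_bigr => x /agree_offP Hx.
  congr (_ * _); apply: Hphi => i iB; apply: Hx.
  by rewrite (disjointFr dBW iB).
rewrite (@marg_peel _ u); last by rewrite inE uU.
rewrite (marg_peel _ _ uU) big_distrl; apply: eq_bigr => a _ /=.
have uW : u \notin W by rewrite (disjointFr dUW uU).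
have -> : (U :|: W) :\ u = (U :\ u) :|: W.
  by apply/setP => i; rewrite !inE; case: eqP => // ->; rewrite (negbTE uW).
rewrite IH.
- congr (_ * _); apply: (marg_local Hpsi) => i; rewrite inE ffunE => /andP[_ iC].
  by case: eqP iC => // -> uC; rewrite (disjointFr dCU uC) in uU.
- exact: disjointWl (subD1set _ _) dUW.
- exact: disjointWr (subD1set _ _) dCU.
Qed.

End Marginals.

(** * Components of the graph off a set of variables *)
Section Components.
Context (V : finType) (SS : {set {set V}}).
Implicit Types (S : seq V) (X W : {set V}) (T : {set V}).

Definition touch X i := [exists T in SS, (i \in T) && [exists j in T, j \in X]].

Definition comp_step S v X := [set i | (i \notin S) && ((i == v) || touch X i)].

(** As many steps as there are vertices reach the least fixed point; it is the
    connected component of [v] off [S], and it is empty if [v] is in [S]. *)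
Definition component S v := iter #|V| (comp_step S v) set0.

Definition closed_off S X := forall T i j,
  T \in SS -> i \in T -> j \in T -> i \in X -> j \notin S -> j \in X.

Definition boundary W := [set i | (i \notin W) && touch W i].

Lemma touchP X i : reflect (exists T j, [/\ T \in SS, i \in T, j \in T & j \in X])
  (touch X i).
Proof.
apply: (iffP exists_inP) => [[T TS /andP[iT /exists_inP[j jT jX]]]|[T [j [TS iT jT jX]]]].
  by exists T, j.
by exists T => //; rewrite iT; apply/exists_inP; exists j.
Qed.

Lemma component_fix S v : comp_step S v (component S v) = component S v.
Proof.
apply: fixsetK => X Y XY; apply/subsetP => i; rewrite !inE => /andP[-> /=].
case: eqP => //= _ /touchP [T [j [TS iT jT jX]]].
by apply/touchP; exists T, j; split => //; apply: (subsetP XY).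
Qed.

Lemma component_avoids S v i : i \in component S v -> i \notin S.
Proof. by rewrite -component_fix inE => /andP[]. Qed.

Lemma component_start S v : v \notin S -> v \in component S v.
Proof. by rewrite -component_fix inE eqxx andbT. Qed.

Lemma component_closed_off S v : closed_off S (component S v).
Proof.
move=> T i j TS iT jT iC jS; rewrite -component_fix inE jS.
by apply/orP; right; apply/touchP; exists T, i.
Qed.

Lemma component_min S v X : closed_off S X -> v \in X -> component S v \subset X.
Proof.
move=> HX vX; rewrite /component; elim: #|V| => [|m IH]; first exact: sub0set.
apply/subsetP => i; rewrite iterS inE => /andP[iS].
case: eqP => [->|_] //= /touchP [T [j [TS iT jT jX]]].
by apply: HX TS jT iT _ iS; apply: (subsetP IH).
Qed.

(** A set that is closed off [S] is a union of components: its complement off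
    [S] is closed as well, since adjacency is symmetric. *)
Lemma component_disjoint S v X : closed_off S X -> v \notin X -> v \notin S ->
  [disjoint component S v & X].
Proof.
move=> HX vX vS; rewrite disjoints_subset; apply/subsetP => i iC.
have HY : closed_off S [set i | (i \notin S) && (i \notin X)].
  move=> T a b TS aT bT; rewrite !inE => /andP[aS aX] bS; rewrite bS /=.
  by apply: contra aX => bX; apply: HX TS bT aT bX aS.
have := component_min HY (_ : v \in _); rewrite inE vS vX => /(_ isT) /subsetP /(_ i iC).
by rewrite !inE => /andP[].
Qed.

End Components.

(** * Eliminating variables *)
Section Elimination.
Local Open Scope ring_scope.
Context (V A : finType) (K : comPzSemiRingType) (SS : {set {set V}}).
Context (g : {set V} -> {ffun V -> A} -> K) (un : V -> A -> K) (a0 : A).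
Hypothesis g_local : forall T, depends (g T) T.
Implicit Types (x y : {ffun V -> A}) (W U X T : {set V}) (S : seq V).
Implicit Types (sigma : seq (V * A)) (tau : seq (V * A) -> V -> option K).

Notation touch := (touch SS).
Notation component := (component SS).
Notation boundary := (boundary SS).

Definition meets T W := [exists j in T, j \in W].

(** The factors that involve [W]; those which do not are constant while the
    variables of [W] are summed out. *)
Definition weight W x : K :=
  (\prod_(T in SS | meets T W) g T x) * \prod_(i in W) un i (x i).

Definition partial W y : K := marg W (weight W) y.

Lemma meetsP T W : reflect (exists2 j, j \in T & j \in W) (meets T W).
Proof. exact: exists_inP. Qed.

Lemma weight_depends W : depends (weight W) (W :|: boundary W).
Proof.
move=> x y Hxy; congr (_ * _); last first.
  by apply: eq_bigr => i iW; rewrite Hxy // inE iW.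
apply: eq_bigr => T /andP[TS /meetsP [j jT jW]]; apply: g_local => i iT.
apply: Hxy; rewrite !inE; case: (boolP (i \in W)) => //= iW.
by apply/touchP; exists T, j.
Qed.

(** A factor that involves [W] has its scope within [W] and its boundary. *)
Lemma partial_local W y y' : {in boundary W, y =1 y'} -> partial W y = partial W y'.
Proof.
move=> H; apply: (marg_local (@weight_depends W)) => i.
by rewrite inE => /andP[iW]; rewrite inE (negbTE iW); exact: H.
Qed.

Lemma partial0 y : partial set0 y = 1.
Proof.
rewrite /partial marg0 /weight !big1 ?mulr1 // => [i|T]; first by rewrite inE.
by move=> /andP[_ /meetsP[j _]]; rewrite inE.
Qed.

(** No factor involves two parts that are not adjacent, so that the weight of
    the union is a product. *)
Lemma partialU U W y : [disjoint U & W] ->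
  (forall T i j, T \in SS -> i \in T -> j \in T -> i \in U -> j \notin W) ->
  partial (U :|: W) y = partial U y * partial W y.
Proof.
move=> dUW sep.
have disj_bd (X Y : {set V}) : [disjoint X & Y] ->
    (forall T i j, T \in SS -> i \in T -> j \in T -> i \in X -> j \notin Y) ->
    [disjoint X :|: boundary X & Y].
  move=> dXY sXY; rewrite disjoints_subset; apply/subsetP => i.
  rewrite !inE => /orP[/(disjointFr dXY) -> //|/andP[_ /touchP [T [j [TS iT jT jX]]]]].
  exact: sXY TS jT iT jX.
rewrite /partial -(marg_split (B := U :|: boundary U) (C := W :|: boundary W)) //.
- apply: eq_bigr => x _; rewrite /weight mulrACA; congr (_ * _); last first.
    rewrite (bigID [in U]) /=; congr (_ * _); apply: eq_bigl => i; rewrite inE.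
      by case: (boolP (i \in U)) => //=; rewrite andbF.
    case: (boolP (i \in U)) => //= [iU|]; last by rewrite andbT.
    by rewrite (disjointFr dUW iU).
  rewrite (bigID (meets^~ U)) /=; congr (_ * _); apply: eq_bigl => T; case TS: (T \in SS) => //=.
    case: (boolP (meets T U)); rewrite ?andbF ?andbT // => /meetsP [j jT jU].
    by apply/meetsP; exists j => //; rewrite inE jU.
  apply/andP/idP => [[/meetsP [j jT]]|/meetsP [j jT jW]].
    rewrite inE => /orP[jU /meetsP[]|jW _]; first by exists j.
    by apply/meetsP; exists j.
  split; first by apply/meetsP; exists j => //; rewrite inE jW orbT.
  apply/negP => /meetsP [i iT iU]; move: (sep _ _ _ TS iT jT iU).
  by rewrite jW.
- exact: weight_depends.
- exact: disj_bd.
- exact: weight_depends.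
- apply: disj_bd; first by rewrite disjoint_sym.
  by move=> T i j TS iT jT iW; apply: contraL iW; exact: sep TS jT iT.
Qed.

(** Once [u] has the value [a], the factors on [u] that avoid the rest of [W]
    are constant. *)
Lemma partial_peel W u y : u \in W ->
  partial W y = \sum_a un u a *
    (\prod_(T in SS | (u \in T) && ~~ meets T (W :\ u)) g T (upd y u a)) *
    partial (W :\ u) (upd y u a).
Proof.
move=> uW; rewrite /partial (marg_peel _ _ uW); apply: eq_bigr => a _.
rewrite /marg big_distrr /=; apply: eq_bigr => x /agree_offP Hx.
have xu : x u = a by rewrite Hx ?ffunE ?eqxx // !inE eqxx.
rewrite /weight (big_setD1 u) //= xu mulrCA -!mulrA; congr (_ * _).
rewrite mulrA; congr (_ * _).
rewrite (bigID (fun T => meets T (W :\ u))) /= mulrC; congr (_ * _).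
  have -> : \prod_(T in SS | (u \in T) && ~~ meets T (W :\ u)) g T (upd y u a) =
     \prod_(T in SS | (u \in T) && ~~ meets T (W :\ u)) g T x.
    apply: eq_bigr => T /and3P[_ _ mT]; apply: g_local => i iT; rewrite Hx //.
    by apply: contra mT => iW; apply/meetsP; exists i.
  apply: eq_bigl => T; case TS: (T \in SS) => //=.
  case: (boolP (meets T (W :\ u))); rewrite ?andbF //= => mT; rewrite !andbT.
  apply/meetsP/idP => [[j jT jW]|uT]; last by exists u.
  case: (eqVneq j u) => [<- //|ju]; case/meetsP: mT; exists j => //.
  by rewrite !inE ju.
apply: eq_bigl => T; case TS: (T \in SS) => //=.
apply: andb_idl => /meetsP [j jT]; rewrite !inE => /andP[_ jW].
by apply/meetsP; exists j.
Qed.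

(** In the options below, [None] is the value of a state not known yet. *)
Definition omul (x y : option K) : option K :=
  if x is Some a then if y is Some b then Some (a * b) else None else None.

Definition oadd (x y : option K) : option K :=
  if x is Some a then if y is Some b then Some (a + b) else None else None.

(** Every partial assignment is extended by the default value [a0]; if a
    variable is repeated in [sigma], the first entry wins. *)
Definition assignment sigma : {ffun V -> A} :=
  [ffun i => foldr (fun p acc => if p.1 == i then p.2 else acc) a0 sigma].

(** With [M] the variable just assigned, these are the factors that have just
    become constant; with [M] empty, those that are constant altogether. *)
Definition local_factor T sigma (M : {set V}) : bool :=
  (M \subset T) && (T \subset unzip1 sigma).

Definition local_product (M : {set V}) sigma : K :=
  foldr (fun T acc => if local_factor T sigma M then g T (assignment sigma) * acc else acc)
    1 (enum SS).

(** Multiplies the value of each component once: [v] is skipped if its component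
    has been met already. *)
Definition cover_step (tau : seq (V * A) -> V -> option K) sigma v
    (acc : {set V} * option K) :=
  if v \in acc.1 then acc
  else (acc.1 :|: component (unzip1 sigma) v, omul (tau sigma v) acc.2).

Definition cover_product tau sigma (W : {set V}) :=
  foldr (cover_step tau sigma) (set0, Some 1) (enum W).

Definition branch tau sigma (D : {set V}) u : option K :=
  foldr (fun a acc => oadd
      (omul (Some (un u a * local_product [set u] ((u, a) :: sigma)))
         (cover_product tau ((u, a) :: sigma) (D :\ u)).2) acc)
    (Some 0) (enum A).

(** Forgetting the variables away from [D] is what keeps the keys of the table
    short. *)
Definition trim sigma (D : {set V}) := [seq p <- sigma | touch D p.1].

(** Any [u] would do; the first one whose branch is known is taken. *)
Definition expand tau sigma v : option K :=
  let D := component (unzip1 sigma) v in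
  foldr (fun u acc => if branch tau (trim sigma D) D u is Some z then Some z else acc)
    None (enum D).

Definition sound tau := forall sigma v z, v \notin unzip1 sigma ->
  tau sigma v = Some z -> z = partial (component (unzip1 sigma) v) (assignment sigma).

Lemma assignment_cons u a sigma : assignment ((u, a) :: sigma) = upd (assignment sigma) u a.
Proof. by apply/ffunP => i; rewrite !ffunE /= eq_sym. Qed.

Lemma local_productE M sigma : local_product M sigma =
  \prod_(T in SS | local_factor T sigma M) g T (assignment sigma).
Proof.
rewrite -big_enum_cond /local_product.
by elim: (enum SS) => [|T s IH]; rewrite ?big_nil ?big_cons //= IH.
Qed.

Lemma assignment_trim sigma D i : touch D i ->
  assignment (trim sigma D) i = assignment sigma i.
Proof.
move=> Hi; rewrite !ffunE; elim: sigma => //= -[j a] sigma IH /=.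
case: ifP => /= Hj; first by rewrite IH.
by case: eqP => // jE; rewrite jE Hi in Hj.
Qed.

Lemma mem_trim sigma D i : (i \in unzip1 (trim sigma D)) = touch D i && (i \in unzip1 sigma).
Proof.
apply/mapP/andP => [[p]|[Hi /mapP [p ps ip]]].
  by rewrite mem_filter => /andP[Hp ps] ->; split => //; apply: map_f.
by exists p => //; rewrite mem_filter -ip Hi.
Qed.

(** The set covered so far is closed off the domain of [sigma], hence a union of
    components, and the next component is not adjacent to it. *)
Lemma cover_foldrP tau sigma W (s : seq V) : sound tau ->
  closed_off SS (unzip1 sigma) W -> (forall i, i \in W -> i \notin unzip1 sigma) ->
  {subset s <= W} ->
  let acc := foldr (cover_step tau sigma) (set0, Some 1) s in
  [/\ closed_off SS (unzip1 sigma) acc.1, acc.1 \subset W, {subset s <= acc.1}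
    & forall z, acc.2 = Some z -> z = partial acc.1 (assignment sigma)].
Proof.
move=> Ht cW aW; elim: s => [|v s IH] sW /=.
  split=> //; first by move=> T i j _ _ _; rewrite inE.
    exact: sub0set.
  by move=> z [<-]; rewrite partial0.
have vW : v \in W by apply: sW; rewrite mem_head.
have [|c1 s1 ss1 z1] := IH; first by move=> i Hi; apply: sW; rewrite inE Hi orbT.
set acc := foldr _ _ _ in c1 s1 ss1 z1 *; rewrite /cover_step.
case: ifPn => Hv.
  by split=> // i; rewrite inE => /orP[/eqP -> //|/ss1].
have vS := aW _ vW.
have dis := component_disjoint c1 Hv vS; rewrite disjoint_sym in dis.
split=> /=.
- move=> T i j TS iT jT; rewrite !inE => /orP[iU|iC] jS; apply/orP; [left|right].
    exact: c1 TS iT jT iU jS.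
  exact: component_closed_off TS iT jT iC jS.
- by rewrite subUset s1 component_min.
- move=> i; rewrite !inE => /orP[/eqP->|/ss1 -> //].
  by rewrite component_start ?orbT.
case Et: (tau sigma v) => [t|] //=; case Ea: acc.2 => [b|] //= z [<-].
rewrite partialU //.
  by rewrite -(z1 _ Ea) -(Ht _ _ _ vS Et) mulrC.
move=> T i j TS iT jT iU; apply/negP => jC.
have := c1 _ _ _ TS iT jT iU (component_avoids jC).
by rewrite (disjointFl dis jC).
Qed.

Lemma cover_product_sound tau sigma W z : sound tau ->
  closed_off SS (unzip1 sigma) W -> (forall i, i \in W -> i \notin unzip1 sigma) ->
  (cover_product tau sigma W).2 = Some z -> z = partial W (assignment sigma).
Proof.
move=> Ht cW aW Hz.
have [|_ s1 s2 z1] := @cover_foldrP _ _ _ (enum W) Ht cW aW; first by move=> i; rewrite mem_enum.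
rewrite (z1 _ Hz); congr (partial _ _); apply/eqP; rewrite eqEsubset s1 /=.
by apply/subsetP => i iW; apply: s2; rewrite mem_enum.
Qed.

(** Assigning [u] separates [D :\ u] from everything else, even after the
    variables away from [D] have been forgotten. *)
Lemma closed_off_trim sigma v u a : let D := component (unzip1 sigma) v in u \in D ->
  closed_off SS (unzip1 ((u, a) :: trim sigma D)) (D :\ u) /\
  (forall i, i \in D :\ u -> i \notin unzip1 ((u, a) :: trim sigma D)).
Proof.
move=> D uD; split=> [T i j TS iT jT|i]; rewrite !inE mem_trim.
  move=> /andP[_ iD]; rewrite negb_or => /andP[-> /= jS].
  apply: (component_closed_off TS iT jT iD); apply: contra jS => ->; rewrite andbT.
  by apply/touchP; exists T, i.
by move=> /andP[/negbTE -> iD] /=; rewrite negb_and (component_avoids iD) orbT.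
Qed.

(** This is [partial_peel]: the product of the components of [D :\ u] is
    [partial (D :\ u)], and a scope that contains [u] avoids [D :\ u] exactly
    when it lies in the domain of the new assignment. *)
Lemma branch_sound tau sigma v u z : sound tau ->
  let D := component (unzip1 sigma) v in u \in D ->
  branch tau (trim sigma D) D u = Some z -> z = partial D (assignment sigma).
Proof.
move=> Ht D uD Hz.
have -> : partial D (assignment sigma) = partial D (assignment (trim sigma D)).
  apply: partial_local => i; rewrite inE => /andP[_ Hi].
  by rewrite assignment_trim.
rewrite (partial_peel _ uD) -big_enum /=; rewrite /branch in Hz.
elim: (enum A) z Hz => [|a s IH] z /=; first by case=> <-; rewrite big_nil.
rewrite big_cons.
have [cW aW] := closed_off_trim a uD.
case Ec: (cover_product _ _ _).2 => [c|] //=.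
set r := foldr _ _ _ => Hz.
case Er: r Hz => [b|] //= [<-]; rewrite (IH b Er) -assignment_cons.
rewrite -(cover_product_sound Ht cW aW Ec); congr (_ * _ * _ + _).
(* the factors selected by the program are those of [partial_peel] *)
rewrite local_productE; apply: eq_bigl => T; case TS: (T \in SS) => //=.
rewrite /local_factor sub1set; case uT: (u \in T) => //=.
apply/subsetP/idP => [sT|mT i iT].
  apply/negP => /meetsP [j jT jD]; move: (aW _ jD); rewrite sT //.
rewrite inE mem_trim; case: (eqVneq i u) => //= iu.
have iD : i \notin D by apply: contra mT => iD; apply/meetsP; exists i => //; rewrite !inE iu.
apply/andP; split; first by apply/touchP; exists T, u.
by apply: contraNT iD => iS; exact: component_closed_off TS uT iT uD iS.
Qed.

Lemma expand_sound tau : sound tau -> sound (expand tau).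
Proof.
move=> Ht sigma v z vS; rewrite /expand.
have : {subset enum (component (unzip1 sigma) v) <= component (unzip1 sigma) v}.
  by move=> i; rewrite mem_enum.
elim: (enum _) => //= u s IH Hs.
case Eb: branch => [b|]; last by apply: IH => i Hi; apply: Hs; rewrite inE Hi orbT.
by move=> [<-]; apply: branch_sound Eb => //; apply: Hs; rewrite mem_head.
Qed.

(** The table holds the keys of size at most [m] only. *)
Definition bounded m tau sigma v : option K :=
  if (size sigma <= m)%N then tau sigma v else None.

Fixpoint table m r : seq (V * A) -> V -> option K :=
  if r is r'.+1 then expand (bounded m (table m r')) else fun _ _ => None.

Definition solve m r : option K :=
  omul (Some (local_product set0 [::])) (cover_product (bounded m (table m r)) [::] setT).2.

Lemma bounded_sound m tau : sound tau -> sound (bounded m tau).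
Proof. by move=> Ht sigma v z vS; rewrite /bounded; case: ifP => // _; exact: Ht. Qed.

Lemma table_sound m r : sound (table m r).
Proof. by elim: r => [//|r IH]; apply/expand_sound/bounded_sound. Qed.

(** The whole set of variables is closed, and the factor of empty scope, if
    any, is the only one that it does not meet. *)
Lemma solve_sound m r z : solve m r = Some z ->
  z = \sum_x (\prod_(T in SS) g T x) * \prod_i un i (x i).
Proof.
rewrite /solve; case Ec: (cover_product _ _ _).2 => [c|] //= [<-].
have -> : c = partial setT (assignment [::]).
  apply: cover_product_sound Ec => //; exact/bounded_sound/table_sound.
rewrite /partial margT big_distrr /=; apply: eq_bigr => x _.
rewrite /weight mulrA; congr (_ * _); last by apply: eq_bigl => i; rewrite inE.
rewrite [in RHS](bigID (meets^~ setT)) /= mulrC; congr (_ * _).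
rewrite local_productE.
have E T : local_factor T [::] set0 = ~~ meets T setT.
  rewrite /local_factor sub0set /=; apply/subsetP/idP => [H|/meetsP H i iT].
    by apply/negP => /meetsP [j /H].
  by case: H; exists i; rewrite ?inE.
under eq_bigl do rewrite E.
apply: eq_bigr => T /andP[_ /meetsP H]; apply: g_local => i iT.
by case: H; exists i; rewrite ?inE.
Qed.

End Elimination.

(** * Treewidth makes the elimination succeed *)
Section JunctionTree.
Context (k : nat) (SS : {set {set 'I_k}}).
Context (J : junction_tree (scope_graph SS)).
Implicit Types (t s : jt_node J) (D X W : {set 'I_k}).

Notation edge := (@jt_edge _ _ J).
Notation bag := (@jt_bag _ _ J).

Definition adjacent i j := [exists T in SS, (i \in T) && (j \in T)].

(** Connectedness of [D] in the scope graph, stated as an induction principle. *)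
Definition linked D := forall X d, d \in D -> d \in X ->
  (forall i j, i \in D -> j \in D -> adjacent i j -> i \in X -> j \in X) ->
  D \subset X.

(** Another walk between the ends of an edge would close a cycle of the tree. *)
Lemma edge_cut t t1 : edge t t1 ->
  ~~ connect [rel a b | edge a b && ((a, b) != (t1, t))] t1 t.
Proof.
have [_ e_sym e_irr _ acyclic] := jt_tree J.
move=> e_tt1; apply/connectP => -[p pth tq]; move: tq; case/shortenP: pth => q pth uq _ tq.
have pth_e : path edge t1 q by apply: sub_path pth => a b /andP[].
case: q => [|a [|b q]] in pth pth_e uq tq *.
- by rewrite tq e_irr in e_tt1.
- by rewrite /= in tq; rewrite -tq /= eqxx !andbF in pth.
apply: (acyclic [:: t1, a, b & q]) => //; rewrite /ucycle uq andbT.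
by rewrite (cycle_path t1) -/(last _ _); move: tq => /= <-; rewrite e_tt1.
Qed.

(** The nodes whose bags meet a connected set form a connected part of the
    tree: adjacent variables share a bag, and the bags of one variable are
    connected. *)
Lemma connect_avoiding D t s s' d d' : linked D ->
  (forall i, i \in D -> i \notin bag t) ->
  d \in D -> d \in bag s -> d' \in D -> d' \in bag s' ->
  connect [rel a b | [&& edge a b, a != t & b != t]] s s'.
Proof.
move=> linkD Dt dD ds d'D d's'.
have within i a b : i \in D -> i \in bag a -> i \in bag b ->
    connect [rel a b | [&& edge a b, a != t & b != t]] a b.
  move=> iD ia ib; apply: connect_sub (jt_subtree ia ib) => x y /= /and3P[exy ix iy].
  apply: connect1; rewrite /= exy /=.
  by apply/andP; split; apply: contra (Dt _ iD) => /eqP <-.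
pose X := [set i | [forall b, (i \in bag b) ==>
   connect [rel a b | [&& edge a b, a != t & b != t]] s b]].
have dX : d \in X.
  by rewrite inE; apply/forallP => b; apply/implyP => db; exact: within db.
have /subsetP/(_ _ d'D) : D \subset X.
  apply: linkD dD dX _ => i j iD jD /exists_inP [T TS /andP[iT jT]].
  rewrite !inE => /forallP Hi; apply/forallP => b; apply/implyP => jb.
  case: (eqVneq i j) jb => [<- ib|ij jb]; first exact: (implyP (Hi b)).
  have [|c /andP[ic jc]] := jt_cover J (x := i) (y := j).
    by rewrite /scope_graph /= ij; apply/exists_inP; exists T => //; rewrite iT.
  by apply: connect_trans (implyP (Hi c) ic) _; exact: within jc jb.
by rewrite inE => /forallP /(_ s') /implyP /(_ d's').
Qed.

(** Take one step of the tree, from [t] to [t1], towards a bag that meets [D].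
    If the bag of [t] avoids [D], then every [x] of [W] is still in the bag of
    [t1].  Otherwise there would be a walk from [t1] to [t] that does not use the
    edge between them: first to a bag that meets [D], then among such bags (thus
    avoiding [t]) to one that contains [x], then back to [t] among the bags of
    [x] (thus avoiding [t1]). *)
Lemma advance_along D W p t : linked D ->
  (forall x, x \in W -> exists2 d, d \in D & adjacent x d) ->
  path edge t p -> uniq (t :: p) -> (exists2 d, d \in D & d \in bag (last t p)) ->
  W \subset bag t ->
  exists t' u, [/\ u \in D, u \in bag t' & W \subset bag t'].
Proof.
have [_ e_sym _ _ _] := jt_tree J.
move=> linkD adjW; elim: p t => [|t1 p IH] t /=.
  by move=> _ _ [d dD dt] Wt; exists t, d.
move=> /andP[e_tt1 pth] /andP[tp up] [d dD dl] Wt.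
have [/exists_inP [u uD ut]|] := boolP [exists u in D, u \in bag t]; first by exists t, u.
rewrite negb_exists_in => /forall_inP Dt.
apply: (IH t1) => //; first by exists d.
apply/subsetP => x xW; apply: contraT => xt1.
have xt := subsetP Wt _ xW.
have [d' d'D /exists_inP [T TS /andP[xT d'T]]] := adjW _ xW.
have [|c /andP[xc d'c]] := jt_cover J (x := x) (y := d').
  rewrite /scope_graph /= (_ : x != d'); last by apply: contraTneq xt => ->; exact: Dt.
  by apply/exists_inP; exists T => //; rewrite xT.
(* the bag of [last t1 p] meets [D], that of [c] contains [x] and [d'] in [D] *)
have := edge_cut e_tt1; apply: contraNT => _.
have avoid a b : connect [rel a b | [&& edge a b, a != t & b != t]] a b ->
    connect [rel a b | edge a b && ((a, b) != (t1, t))] a b.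
  apply: connect_sub => y z /= /and3P[eyz yt zt]; apply: connect1 => /=.
  by rewrite eyz xpair_eqE (negbTE zt) andbF.
apply: (@connect_trans _ _ (last t1 p)).
  apply: avoid; apply/connectP; exists p => //.
  elim: p t1 pth tp {IH up dl xt1 e_tt1} => //= y p IH t1 /andP[-> pth].
  rewrite !inE !negb_or => /and3P[tt1 ty tp]; rewrite eq_sym tt1 eq_sym ty /=.
  by apply: IH => //; rewrite inE negb_or ty.
apply: (@connect_trans _ _ c).
  by apply: avoid; apply: connect_avoiding linkD Dt dD dl d'D d'c.
apply: connect_sub (jt_subtree xc xt) => y z /= /and3P[eyz xy xz].
apply: connect1; rewrite /= eyz xpair_eqE.
by case: eqP xy => // ->; rewrite (negbTE xt1).
Qed.

Lemma advance D W d t : linked D -> d \in D ->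
  (forall x, x \in W -> exists2 d, d \in D & adjacent x d) ->
  W \subset bag t ->
  exists t' u, [/\ u \in D, u \in bag t' & W \subset bag t'].
Proof.
have [_ _ _ conn _] := jt_tree J.
move=> linkD dD adjW Wt; have [s ds] := jt_vertex J d.
have /connectP [p pth sl] := conn t s.
move: sl; case/shortenP: pth => q pth uq _ sl.
by apply: advance_along linkD adjW pth uq _ Wt; exists d => //; rewrite -sl.
Qed.

Lemma node_exists : exists t : jt_node J, True.
Proof. by have [/card_gt0P [t _] _ _ _ _] := jt_tree J; exists t. Qed.

(** The Helly property of subtrees, from [advance] applied to the singletons of
    [T] in turn. *)
Lemma scope_in_bag T : T \in SS -> exists t, T \subset bag t.
Proof.
move=> TS; suff: forall X, X \subset T -> exists t, X \subset bag t by apply.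
apply: (@card_ind 'I_k) => [_|X u uX IH XT].
  by have [t _] := node_exists; exists t; exact: sub0set.
have [|t Xt] := IH; first exact: subset_trans (subD1set _ _) XT.
have [||x|t' [u' []]] := @advance [set u] (X :\ u) u t _ _ _ Xt.
- by move=> Y d; rewrite inE => /eqP -> uY _; rewrite sub1set.
- by rewrite inE.
- move=> xX; exists u; first by rewrite inE.
  apply/exists_inP; exists T => //; rewrite (subsetP XT _ uX) andbT.
  by move: xX; rewrite inE => /andP[_ /(subsetP XT)].
rewrite inE => /eqP -> ut' Xt'; exists t'.
by rewrite -(setD1K uX) subUset sub1set ut'.
Qed.

Lemma component_linked S v : v \notin S -> linked (component SS S v).
Proof.
move=> vS X d dD dX HX.
have cY : closed_off SS S (component SS S v :&: X).
  move=> T i j TS iT jT; rewrite !inE => /andP[iD iX] jS.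
  have jD := component_closed_off TS iT jT iD jS; rewrite jD /=.
  by apply: HX iX => //; apply/exists_inP; exists T => //; rewrite iT.
have [vY|vY] := boolP (v \in component SS S v :&: X).
  exact: subset_trans (component_min cY vY) (subsetIr _ _).
by have /disjointFr/(_ dD) := component_disjoint cY vY vS; rewrite inE dD dX.
Qed.

(** The bound [m] on the bags is also the bound on the keys of the table. *)
Section Completeness.
Context (A : finType) (K : comPzSemiRingType).
Context (g : {set 'I_k} -> {ffun 'I_k -> A} -> K) (un : 'I_k -> A -> K) (a0 : A).
Context (m : nat).
Implicit Types (tau : seq ('I_k * A) -> 'I_k -> option K) (sigma : seq ('I_k * A)).
Hypothesis bag_le : forall t, #|bag t| <= m.

Notation table := (table SS g un a0 m).

Lemma cover_product_some tau sigma W :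
  (forall v, v \in W -> tau sigma v <> None) ->
  (cover_product SS tau sigma W).2 <> None.
Proof.
rewrite /cover_product => H.
have : {subset enum W <= W} by move=> i; rewrite mem_enum.
elim: (enum W) => //= v s IH sW; rewrite /cover_step.
have IH' := IH (fun i si => sW i (mem_behead (s := v :: s) si)).
case: ifP => _ //=; have := H v (sW v (mem_head _ _)).
by case: (tau sigma v) => // a _; case: (_.2) IH'.
Qed.

Lemma branch_some tau sigma D u :
  (forall a, (cover_product SS tau ((u, a) :: sigma) (D :\ u)).2 <> None) ->
  branch SS g un a0 tau sigma D u <> None.
Proof.
move=> H; rewrite /branch; elim: (enum A) => //= a s.
by case: (foldr _ _ s) => // b _; have := H a; case: (cover_product _ _ _ _).2.
Qed.

Lemma expand_some tau sigma v u : u \in component SS (unzip1 sigma) v ->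
  branch SS g un a0 tau (trim SS sigma (component SS (unzip1 sigma) v))
    (component SS (unzip1 sigma) v) u <> None ->
  expand SS g un a0 tau sigma v <> None.
Proof.
move=> uD Hu; rewrite /expand.
have : u \in enum (component SS (unzip1 sigma) v) by rewrite mem_enum.
elim: (enum _) => //= x s IH; rewrite inE => /orP[/eqP <-|/IH].
  by case: branch Hu.
by case: branch.
Qed.

(** By induction on the rounds: [advance] provides a variable [u] for which the
    new assignment has its domain in one bag, thus at most [m] entries, and the
    components that remain are smaller, with their boundaries in that bag. *)
Lemma table_some r sigma v t : uniq (unzip1 sigma) -> v \notin unzip1 sigma ->
  #|component SS (unzip1 sigma) v| <= r ->
  boundary SS (component SS (unzip1 sigma) v) \subset bag t ->
  table r sigma v <> None.
Proof.
elim: r sigma v t => [|r IH] sigma v t us vS.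
  by rewrite leqn0 cards_eq0 => /eqP D0; have := component_start SS vS; rewrite D0 inE.
set D := component SS _ v => cD bD.
have [x|t' [u [uD ut' bD']]] := advance (component_linked vS) (component_start SS vS) _ bD.
  rewrite inE => /andP[_ /touchP [T [j [TS xT jT jD]]]].
  by exists j => //; apply/exists_inP; exists T => //; rewrite xT.
apply: (@expand_some _ _ _ u) => //; rewrite -/D.
apply: branch_some => a; apply: cover_product_some => v' v'W.
have [cW aW] := closed_off_trim a uD.
(* the new assignment only mentions [u] and the boundary of [D] *)
have in_bag i : i \in unzip1 ((u, a) :: trim SS sigma D) -> i \in bag t'.
  rewrite inE mem_trim => /orP[/eqP -> //|/andP[Hi iS]].
  apply: (subsetP bD'); rewrite inE Hi andbT.
  by apply: contraL iS => /component_avoids.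
have us' : uniq (unzip1 ((u, a) :: trim SS sigma D)).
  rewrite /= mem_trim (negbTE (component_avoids uD)) andbF /=.
  by apply: subseq_uniq us; apply: map_subseq; exact: filter_subseq.
rewrite /bounded ifT; last first.
  rewrite -(size_map fst); apply: leq_trans (bag_le t').
  by rewrite cardE; apply: uniq_leq_size us' _ => i /in_bag; rewrite mem_enum.
apply: (IH _ _ t') => //; first exact: aW.
- rewrite -ltnS; apply: leq_trans cD.
  rewrite (cardsD1 u D) uD ltnS; apply: subset_leq_card.
  exact: component_min.
- apply/subsetP => i; rewrite inE => /andP[iD' /touchP [T [j [TS iT jT jD']]]].
  apply: in_bag; apply: contraNT iD' => iS.
  exact: component_closed_off TS jT iT jD' iS.
Qed.

Lemma solve_some : solve SS g un a0 m k <> None.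
Proof.
rewrite /solve; have : (cover_product SS (bounded m (table k)) [::] setT).2 <> None.
  apply: cover_product_some => v _; have [t _] := node_exists.
  apply: (@table_some _ _ _ t) => //.
    by rewrite -[X in _ <= X]card_ord max_card.
  apply/subsetP => i; rewrite inE => /andP[iD /touchP [T [j [TS iT jT jD]]]].
  by rewrite (component_closed_off TS jT iT jD) in iD.
by case: (_.2).
Qed.

End Completeness.

(** A set of at most [m] variables is the image of an [m]-tuple, padded with
    [None]. *)
Lemma card_scopes m : (forall t, #|bag t| <= m) -> #|SS| <= k.+1 ^ m.
Proof.
move=> Hm; rewrite -[k.+1](_ : #|{: option 'I_k}| = _); last by rewrite card_option card_ord.
rewrite -card_tuple.
pose f (x : m.-tuple (option 'I_k)) := [set i | Some i \in x].
have sub : SS \subset [set f x | x : m.-tuple (option 'I_k)].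
  apply/subsetP => T TS; have [t Tt] := scope_in_bag TS.
  have cT : #|T| <= m := leq_trans (subset_leq_card Tt) (Hm t).
  have sz : size (map Some (enum T) ++ nseq (m - #|T|) None) == m.
    by rewrite size_cat size_map size_nseq -cardE subnKC.
  apply/imsetP; exists (Tuple sz) => //; apply/setP => i; rewrite inE /=.
  by rewrite mem_cat mem_nseq andbF orbF mem_map ?mem_enum //.
apply: leq_trans (subset_leq_card sub) _.
exact: leq_trans (leq_imset_card _ _) (max_card _).
Qed.

End JunctionTree.

Local Open Scope ring_scope.

(** * The program *)

(** In the environments below the arguments come first.  Where the last argument
    is followed by the globals, these are five entries: [k] in unary, the lists
    of variables, of values and of scopes, and the argument of the oracle.  With
    [p] entries before them, the globals thus have the indices [p] to [p + 4],
    and a call that passes them on drops [p] entries. *)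

(** Arguments: a variable, a partial assignment. *)
Definition l_assigned := l_any (LVar 1) (l_call 0 l_eqn [:: l_head (LVar 1); LVar 2]).

(** Arguments: a partial assignment, a variable.  The default value [LNil] is
    the number 0. *)
Definition l_val := LFold (LVar 0) LNil
  (LIf (l_call 0 l_eqn [:: l_head (LVar 1); LVar 3]) (l_tail (LVar 1)) (LVar 0)).

(** Arguments: a set, a variable; globals. *)
Definition l_touch := l_any (LVar 5)
  (l_and (l_call 0 l_mem [:: LVar 3; LVar 1]) (l_call 0 l_inter [:: LVar 1; LVar 2])).

(** Arguments: a partial assignment, a variable; globals. *)
Definition l_component := LFold (LVar 2) LNil
  (l_filter (LVar 5)
    (l_and (l_not (l_call 0 l_assigned [:: LVar 1; LVar 4]))
          (l_or (l_call 0 l_eqn [:: LVar 1; LVar 5])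
               (l_call 6 l_touch [:: LVar 2; LVar 1])))).

Definition l_eqpair :=
  l_and (l_call 0 l_eqn [:: l_head (LVar 0); l_head (LVar 1)])
       (l_call 0 l_eqn [:: l_tail (LVar 0); l_tail (LVar 1)]).

(** Two lists cannot be scanned in parallel by a fold; but the keys have bounded
    length, so that the scan can be unrolled in the program. *)
Fixpoint l_eqseq (m : nat) : loop :=
  if m is m'.+1 then
    LMatch (LVar 0) (l_not (LVar 1))
      (LMatch (LVar 3) LNil
        (l_and (l_call 0 l_eqpair [:: LVar 2; LVar 0])
              (l_call 0 (l_eqseq m') [:: LVar 3; LVar 1])))
  else l_not (LVar 1).

(** Arguments: the table, a partial assignment, a variable. *)
Definition l_lookup m := LFold (LVar 0) LNil
  (LIf (l_and (l_call 0 (l_eqseq m) [:: l_head (l_head (LVar 1)); LVar 3])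
             (l_call 0 l_eqn [:: l_tail (l_head (LVar 1)); LVar 4]))
    (l_tail (LVar 1)) (LVar 0)).

Definition l_lift2 op := LMatch (LVar 0) LNil
  (LMatch (LVar 3) LNil (l_some (l_call 0 op [:: LVar 2; LVar 0]))).

(** The unary weight is computed from a variable and a value, the weight of a
    factor from the answer of the query; both may use the globals. *)
Record semiring_code := SemiringCode {
  code_zero : loop; code_one : loop; code_add : loop; code_mul : loop;
  code_unary : loop; code_factor : loop
}.

Section Code.
Variable c : semiring_code.

(** Arguments: a set, a partial assignment; globals. *)
Definition l_local := LFold (LVar 5) (code_one c)
  (LIf (l_and (l_call 0 l_subset [:: LVar 2; LVar 1])
             (l_all (LVar 1) (l_call 0 l_assigned [:: LVar 1; LVar 5])))
    (l_call 0 (code_mul c)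
      [:: l_call 4 (code_factor c)
            [:: LQuery (LCons (LVar 1)
                 (l_map (LVar 1) (l_call 0 l_val [:: LVar 5; LVar 1])))];
          LVar 0])
    (LVar 0)).

(** Arguments: the table, a partial assignment, a set; globals. *)
Definition l_cover m := LFold (LVar 2) (LCons LNil (l_some (code_one c)))
  (LIf (l_call 0 l_mem [:: LVar 1; l_head (LVar 0)]) (LVar 0)
    (LLet (l_call 5 l_component [:: LVar 3; LVar 1])
      (LCons
        (l_filter (LVar 7)
          (l_or (l_call 0 l_mem [:: LVar 1; l_head (LVar 3)])
               (l_call 0 l_mem [:: LVar 1; LVar 2])))
        (l_call 0 (l_lift2 (code_mul c))
          [:: l_call 0 (l_lookup m) [:: LVar 3; LVar 4; LVar 2];
              l_tail (LVar 1)])))).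

(** Arguments: the table, a partial assignment, a set, a variable; globals. *)
Definition l_branch m := LFold (LVar 6) (l_some (code_zero c))
  (LLet (LCons (LCons (LVar 5) (LVar 1)) (LVar 3))
    (l_call 0 (l_lift2 (code_add c))
      [:: l_call 0 (l_lift2 (code_mul c))
            [:: l_some (l_call 0 (code_mul c)
                  [:: l_call 7 (code_unary c) [:: LVar 6; LVar 2];
                      l_call 7 l_local [:: LCons (LVar 6) LNil; LVar 0]]);
                l_tail (l_call 7 (l_cover m)
                  [:: LVar 3; LVar 0;
                      l_filter (LVar 8)
                        (l_and (l_not (l_call 0 l_eqn [:: LVar 1; LVar 8]))
                              (l_call 0 l_mem [:: LVar 1; LVar 7]))])];
          LVar 1])).

(** Arguments: the table, a partial assignment, a variable; globals. *)
Definition l_expand m :=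
  LLet (l_call 3 l_component [:: LVar 1; LVar 2])
  (LLet (l_filter (LVar 2) (l_call 6 l_touch [:: LVar 2; l_head (LVar 1)]))
    (LFold (LVar 1) LNil
      (LLet (l_call 7 (l_branch m) [:: LVar 4; LVar 2; LVar 3; LVar 1])
        (LIf (LVar 0) (LVar 0) (LVar 1))))).

Fixpoint l_keys (m : nat) : loop :=
  if m is m'.+1 then
    LLet (l_keys m')
    (LLet (l_pairs (LVar 2) (LVar 5) (LCons (LVar 3) (LVar 1)))
      (LCons LNil (l_pairs (LVar 0) (LVar 3) (LCons (LVar 3) (LVar 1)))))
  else LCons LNil LNil.

(** Arguments: the keys; globals. *)
Definition l_table0 := l_pairs (LVar 0) (LVar 4) (LCons (LCons (LVar 3) (LVar 1)) LNil).

(** Arguments: the table, the keys; globals. *)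
Definition l_table m := l_pairs (LVar 1) (LVar 5)
  (LCons (LCons (LVar 3) (LVar 1))
         (l_call 6 (l_expand m) [:: LVar 4; LVar 3; LVar 1])).

Definition l_solve m :=
  LLet (l_keys m)
  (LLet (LLet l_table0 (LFold (LVar 2) (LVar 0) (l_call 4 (l_table m) [:: LVar 0; LVar 3])))
    (l_call 0 (l_lift2 (code_mul c))
      [:: l_some (l_call 2 l_local [:: LNil; LNil]);
          l_tail (l_call 2 (l_cover m) [:: LVar 0; LNil; LVar 3])])).

End Code.

(** All lists of at most [m] entries; those that repeat a variable are harmless,
    and keeping them spares the program a test. *)
Fixpoint keys (V A : finType) (m : nat) : seq (seq (V * A)) :=
  if m is m'.+1 then
    [::] :: [seq p :: s | p <- [seq (i, a) | i <- enum V, a <- enum A], s <- keys V A m']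
  else [:: [::]].

Lemma mem_keys (V A : finType) m (s : seq (V * A)) : (s \in keys V A m) = (size s <= m)%N.
Proof.
elim: m s => [|m IH] [|p s] //=; rewrite inE /= ltnS -IH.
apply/allpairsP/idP => [[[q t] [_ /= ts [_ ->]]]|sm] //.
exists (p, s); split => //=; case: p => i a.
by apply/allpairsP; exists (i, a); rewrite /= !mem_enum.
Qed.

Lemma size_keysS (V A : finType) m :
  size (keys V A m.+1) = (#|V| * #|A| * size (keys V A m)).+1.
Proof. by rewrite /= !size_allpairs -!cardE. Qed.

Lemma size_keys (V A : finType) m : (size (keys V A m) <= (#|V| * #|A|).+1 ^ m)%N.
Proof.
elim: m => [|m IH] //; rewrite size_keysS expnS mulSn.
by rewrite -add1n leq_add ?expn_gt0 // leq_mul2l IH orbT.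
Qed.

Section Correctness.
Context (R : realType) (explog : bool).
Context (query : value R -> value R -> nat -> Prop) (N : nat).
Implicit Types (env : seq (value R)).

Notation runs := (runs explog query N).

Context (k n : nat) (SS : {set {set 'I_k}}) (a0 : 'I_n).
Context (K : comPzSemiRingType) (encK : K -> value R) (c : semiring_code).
Context (f : {set 'I_k} -> {ffun 'I_k -> 'I_n} -> R).
Context (g : {set 'I_k} -> {ffun 'I_k -> 'I_n} -> K) (un : 'I_k -> 'I_n -> K).
Context (arg : value R) (m : nat).
Hypothesis a0E : a0 = 0%N :> nat.
Hypothesis le_kN : (k <= N)%N.
Hypothesis le_nN : (n <= N)%N.
Hypothesis le_SN : (#|SS| <= N)%N.
Hypothesis le_mN : (m.+1 <= N)%N.
Hypothesis le_knN : (k * n <= N)%N.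
Hypothesis le_keysN : (size (keys 'I_k 'I_n m) * k <= N)%N.
Hypothesis k_gt0 : (0 < k)%N.

Notation enc_var := (@enc_ord R k).
Notation enc_val := (@enc_ord R n).
Notation enc_part := (enc_list (enc_pair enc_var enc_val)).
Notation encO := (enc_option encK).

Definition globals : seq (value R) :=
  [:: enc_nat R k; enc_list enc_var (enum 'I_k);
      enc_list enc_val (enum 'I_n);
      enc_list (@enc_set R k) (enum SS); arg].

Notation G := globals.

Hypothesis run_query : forall T (x : {ffun 'I_k -> 'I_n}), T \in SS -> exists2 e,
  query (VCons (enc_set R T) (enc_seq [seq enc_ord R (x i) | i <- enum T]))
        (VReal (f T x)) e & (e <= N)%N.
Hypothesis run_zero : forall env, runs (code_zero c) env (encK 0).
Hypothesis run_one : forall env, runs (code_one c) env (encK 1).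
Hypothesis run_add : forall x y env,
  runs (code_add c) [:: encK x, encK y & env] (encK (x + y)).
Hypothesis run_mul : forall x y env,
  runs (code_mul c) [:: encK x, encK y & env] (encK (x * y)).
Hypothesis run_unary : forall u a,
  runs (code_unary c) [:: enc_ord R u, enc_ord R a & G] (encK (un u a)).
Hypothesis run_factor : forall T (x : {ffun 'I_k -> 'I_n}), T \in SS ->
  runs (code_factor c) (VReal (f T x) :: G) (encK (g T x)).

Implicit Types (sigma : seq ('I_k * 'I_n)) (tau : seq ('I_k * 'I_n) -> 'I_k -> option K).

Lemma enc_set0 : enc_set R (set0 : {set 'I_k}) = VNil.
Proof. by rewrite enc_setE enum_set0. Qed.

Lemma enc_set1 (u : 'I_k) : enc_set R [set u] = VCons (enc_ord R u) VNil.
Proof. by rewrite enc_setE enum_set1. Qed.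

Lemma run_assigned i sigma env : (size sigma <= N)%N ->
  runs l_assigned [:: enc_ord R i, enc_part sigma & env] (enc_bool R (i \in unzip1 sigma)).
Proof.
move=> Hs; have -> : (i \in unzip1 sigma) = has (fun p => p.1 == i) sigma.
  by rewrite -has_pred1 has_map; apply: eq_has => p /=.
apply: (run_any (enc := enc_pair enc_var enc_val)) => // p v _.
apply: (run_call2 (u1 := enc_ord R p.1) (u2 := enc_ord R i)) => //.
  exact: (run_head (v := enc_ord R p.2)).
exact: run_eq_ord.
Qed.

Lemma run_val i sigma env : (size sigma <= N)%N ->
  runs l_val [:: enc_part sigma, enc_ord R i & env] (enc_ord R (assignment a0 sigma i)).
Proof.
move=> Hs; rewrite ffunE.
apply: (run_fold (enc := enc_pair enc_var enc_val)) => //.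
  by rewrite /enc_ord a0E.
move=> p a _; rewrite [X in runs _ _ X]fun_if.
apply: run_if_eq => //; last exact: (run_tail (u := enc_ord R p.1)).
apply: (run_call2 (u1 := enc_ord R p.1) (u2 := enc_ord R i)) => //.
  exact: (run_head (v := enc_ord R p.2)).
exact: run_eq_ord.
Qed.

Lemma run_touch X i : runs l_touch [:: enc_set R X, enc_ord R i & G]
  (enc_bool R (touch SS X i)).
Proof.
have -> : touch SS X i = has (fun T : {set 'I_k} => (i \in T) && [exists j in T, j \in X]) (enum SS).
  apply/exists_inP/hasP => [[T TS H]|[T]]; first by exists T; rewrite ?mem_enum.
  by rewrite mem_enum => TS H; exists T.
apply: (run_any (enc := @enc_set R k)) => //; first by rewrite -cardE.
move=> T v _; apply: run_and.
  by apply: (run_call2 (u1 := enc_ord R i) (u2 := enc_set R T)) => //; exact: run_mem_set.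
by apply: (run_call2 (u1 := enc_set R T) (u2 := enc_set R X)) => //; exact: run_inter.
Qed.

Lemma run_component sigma v : (size sigma <= N)%N ->
  runs l_component [:: enc_part sigma, enc_ord R v & G]
    (enc_set R (component SS (unzip1 sigma) v)).
Proof.
move=> Hs; rewrite /component card_ord.
apply: (run_iter (encA := @enc_set R k)) => //.
  exact: enc_set0.
move=> X; apply: run_filter_set => // i w; apply: run_and.
  apply: run_not.
  by apply: (run_call2 (u1 := enc_ord R i) (u2 := enc_part sigma)) => //; exact: run_assigned.
apply: run_or.
  by apply: (run_call2 (u1 := enc_ord R i) (u2 := enc_ord R v)) => //; exact: run_eq_ord.
by apply: (run_call2 (u1 := enc_set R X) (u2 := enc_ord R i)) => //; exact: run_touch.
Qed.

Lemma run_eqpair (p q : 'I_k * 'I_n) env :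
  runs l_eqpair [:: enc_pair enc_var enc_val p,
    enc_pair enc_var enc_val q & env] (enc_bool R (p == q)).
Proof.
case: p q => [i a] [j b]; rewrite xpair_eqE; apply: run_and.
  apply: (run_call2 (u1 := enc_ord R i) (u2 := enc_ord R j)).
  - exact: (run_head (v := enc_ord R a)).
  - exact: (run_head (v := enc_ord R b)).
  - exact: run_eq_ord.
apply: (run_call2 (u1 := enc_ord R a) (u2 := enc_ord R b)).
- exact: (run_tail (u := enc_ord R i)).
- exact: (run_tail (u := enc_ord R j)).
- exact: run_eq_ord.
Qed.

Lemma run_eqseq l (s r : seq ('I_k * 'I_n)) env : (size s <= l)%N ->
  runs (l_eqseq l) [:: enc_part s, enc_part r & env] (enc_bool R (s == r)).
Proof.
have nil env' i (t : seq ('I_k * 'I_n)) : onth env' i = Some (enc_part t) ->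
    runs (l_not (LVar i)) env' (enc_bool R ([::] == t)).
  by move=> H; exists (enc_part t) => //; case: t {H} => //; exact: run_true.
elim: l s r env => [|l IH] [|p s] r env //= Hs; try exact: nil.
  by exists (enc_part [::]) => //=; exact: nil.
exists (enc_part (p :: s)) => //=; exists (enc_part r) => //.
case: r => [|q r] //=; rewrite eqseq_cons; apply: run_and.
  apply: (run_call2 (u1 := enc_pair enc_var enc_val p)
   (u2 := enc_pair enc_var enc_val q)) => //; exact: run_eqpair.
by apply: (run_call2 (u1 := enc_part s) (u2 := enc_part r)) => //; exact: IH.
Qed.

Definition enc_entry : (seq ('I_k * 'I_n) * 'I_k) * option K -> value R :=
  enc_pair (enc_pair enc_part enc_var) encO.

Definition entries tau : seq ((seq ('I_k * 'I_n) * 'I_k) * option K) :=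
  [seq ((s, i), tau s i) | s <- keys 'I_k 'I_n m, i <- enum 'I_k].

Definition enc_table tau : value R := enc_list enc_entry (entries tau).

Lemma size_entries tau : (size (entries tau) <= N)%N.
Proof. by rewrite size_allpairs size_enum_ord. Qed.

Lemma lookupE tau sigma v : foldr (fun e acc =>
    if (e.1.1 == sigma) && (e.1.2 == v) then e.2 else acc) None (entries tau) =
  bounded m tau sigma v.
Proof.
rewrite /bounded -mem_keys.
set b := sigma \in _; have : b = ((sigma, v) \in map fst (entries tau)).
  apply/idP/mapP => [Hb|[e /allpairsP [[s i] [/= Hs _ ->]] [E _]]]; last by rewrite /b E.
  exists ((sigma, v), tau sigma v) => //.
  by apply/allpairsP; exists (sigma, v); rewrite mem_enum.
move=> ->.
have : forall e, e \in entries tau -> e.2 = tau e.1.1 e.1.2.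
  by move=> e /allpairsP [[s i] [/= _ _ ->]].
elim: (entries tau) => [|[[s i] z] es IH] //= He.
rewrite inE xpair_eqE (eq_sym sigma) (eq_sym v) IH => [|e es_e]; last first.
  by apply: He; rewrite inE es_e orbT.
by case: andP => [[/eqP <- /eqP <-]|] //=; rewrite -(He _ (mem_head _ _)).
Qed.

Lemma run_lookup tau sigma v env :
  runs (l_lookup m) [:: enc_table tau, enc_part sigma, enc_ord R v & env]
    (encO (bounded m tau sigma v)).
Proof.
rewrite -lookupE.
apply: (run_fold (enc := enc_entry) (encA := encO)) => //; first exact: size_entries.
move=> [[s i] z] a /allpairsP [[s' i'] [/= Hs _ [-> -> _]]].
rewrite mem_keys in Hs.
rewrite [encO (if _ then _ else _)]fun_if; apply: run_if_eq => //; last first.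
  exact: (run_tail (u := VCons (enc_part s') (enc_ord R i'))).
have run_e1 : runs (l_head (LVar 1)) [:: encO a, enc_entry (s', i', z), enc_table tau,
   enc_part sigma, enc_ord R v & env] (VCons (enc_part s') (enc_ord R i')).
  exact: (run_head (v := encO z)).
apply: run_and.
  apply: (run_call2 (u1 := enc_part s') (u2 := enc_part sigma)) => //.
    exact: run_head run_e1.
  exact: run_eqseq.
apply: (run_call2 (u1 := enc_ord R i') (u2 := enc_ord R v)) => //.
  exact: run_tail run_e1.
exact: run_eq_ord.
Qed.

Lemma run_lift2 op (opK : K -> K -> K) x y env :
  (forall a b env, runs op [:: encK a, encK b & env] (encK (opK a b))) ->
  runs (l_lift2 op) [:: encO x, encO y & env]
    (encO (if x is Some a then if y is Some b then Some (opK a b) else None else None)).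
Proof.
move=> Hop; exists (encO x) => //; case: x => [a|] //=.
exists (encO y) => //; case: y => [b|] //=.
apply: run_cons => //.
by apply: (run_call2 (u1 := encK a) (u2 := encK b)).
Qed.

Lemma run_local M sigma : (size sigma <= N)%N ->
  runs (l_local c) [:: enc_set R M, enc_part sigma & G]
    (encK (local_product SS g a0 M sigma)).
Proof.
move=> Hs; rewrite /local_product.
apply: (run_fold (enc := @enc_set R k) (encA := encK)) => //; first by rewrite -cardE.
move=> T a; rewrite mem_enum => TS; rewrite fun_if.
apply: run_if_eq => //.
  apply: run_and.
    by apply: (run_call2 (u1 := enc_set R M) (u2 := enc_set R T)) => //; exact: run_subset.
  have -> : (T \subset unzip1 sigma) = all (mem (unzip1 sigma)) (enum T).
    by apply/subsetP/allP => H j; [rewrite mem_enum | rewrite -mem_enum]; exact: H.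
  apply: (run_all (enc := enc_var)) => //; first exact: size_enum_le.
  move=> i v _.
  by apply: (run_call2 (u1 := enc_ord R i) (u2 := enc_part sigma)) => //; exact: run_assigned.
apply: (run_call2 (u1 := encK (g T (assignment a0 sigma))) (u2 := encK a)) => //.
apply: (run_call1 (u := VReal (f T (assignment a0 sigma)))); last exact: run_factor.
have [e He Le] := run_query (assignment a0 sigma) TS.
exists (VCons (enc_set R T) (enc_seq [seq enc_ord R (assignment a0 sigma i) | i <- enum T])), e.
split=> //; apply: run_cons => //.
rewrite (map_comp enc_val (assignment a0 sigma)).
apply: (run_map (enc := enc_var) (encY := enc_val)) => //.
  exact: size_enum_le.
move=> i v _.
by apply: (run_call2 (u1 := enc_part sigma) (u2 := enc_ord R i)) => //; exact: run_val.
Qed.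

Lemma run_cover tau sigma W : (size sigma <= N)%N ->
  runs (l_cover c m) [:: enc_table tau, enc_part sigma, enc_set R W & G]
    (enc_pair (@enc_set R k) encO (cover_product SS (bounded m tau) sigma W)).
Proof.
move=> Hs; rewrite /cover_product.
apply: (run_fold (enc := enc_var) (encA := enc_pair (@enc_set R k) encO)) => //.
- exact: size_enum_le.
- apply: run_cons; first exact: enc_set0.
  exact: run_cons.
move=> v [U z] _; rewrite /cover_step /= fun_if.
apply: run_if_eq => //.
  apply: (run_call2 (u1 := enc_ord R v) (u2 := enc_set R U)) => //; last exact: run_mem_set.
  exact: (run_head (v := encO z)).
apply: (run_let (u := enc_set R (component SS (unzip1 sigma) v))).
  by apply: (run_call2 (u1 := enc_part sigma) (u2 := enc_ord R v)) => //; exact: run_component.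
apply: run_cons => /=.
  have -> : U :|: component SS (unzip1 sigma) v =
    [set i | (i \in U) || (i \in component SS (unzip1 sigma) v)].
    by apply/setP => i; rewrite !inE.
  apply: run_filter_set => // i w; apply: run_or.
    apply: (run_call2 (u1 := enc_ord R i) (u2 := enc_set R U)) => //; last exact: run_mem_set.
    exact: (run_head (v := encO z)).
  by apply: (run_call2 (u1 := enc_ord R i) (u2 := enc_set R (component SS (unzip1 sigma) v))) => //;
    exact: run_mem_set.
apply: (run_call2 (u1 := encO (bounded m tau sigma v)) (u2 := encO z)).
- apply: (run_call3 (u1 := enc_table tau) (u2 := enc_part sigma) (u3 := enc_ord R v)) => //.
  exact: run_lookup.
- exact: (run_tail (u := enc_set R U)).
- exact: run_lift2.
Qed.

Lemma run_branch tau sigma D u : (size sigma < N)%N ->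
  runs (l_branch c m) [:: enc_table tau, enc_part sigma, enc_set R D, enc_ord R u & G]
    (encO (branch SS g un a0 (bounded m tau) sigma D u)).
Proof.
move=> Hs; rewrite /branch.
apply: (run_fold (enc := enc_val) (encA := encO)) => //.
- by rewrite size_enum_ord.
- exact: run_cons.
move=> a z _.
apply: (run_let (u := enc_part ((u, a) :: sigma))).
  by apply: run_cons => //; exact: run_cons.
set x := omul _ _.
apply: (run_call2 (u1 := encO x) (u2 := encO z)) => //; last exact: run_lift2.
set cp := cover_product _ _ _ _ in x *.
apply: (run_call2 (u1 := encO (Some (un u a * local_product SS g a0 [set u] ((u, a) :: sigma))))
  (u2 := encO cp.2)); last exact: run_lift2.
- apply: run_cons => //.
  apply: (run_call2 (u1 := encK (un u a))
    (u2 := encK (local_product SS g a0 [set u] ((u, a) :: sigma)))) => //.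
    by apply: (run_call2 (u1 := enc_ord R u) (u2 := enc_ord R a)).
  apply: (run_call2 (u1 := enc_set R [set u]) (u2 := enc_part ((u, a) :: sigma))) => //.
    by rewrite enc_set1; exact: run_cons.
  exact: run_local.
- apply: (run_tail (u := enc_set R cp.1)).
  apply: (run_call3 (u1 := enc_table tau) (u2 := enc_part ((u, a) :: sigma))
    (u3 := enc_set R (D :\ u))) => //.
    have -> : D :\ u = [set i | (i != u) && (i \in D)] by apply/setP => i; rewrite !inE.
    apply: run_filter_set => // i w; apply: run_and.
      apply: run_not.
      by apply: (run_call2 (u1 := enc_ord R i) (u2 := enc_ord R u)) => //; exact: run_eq_ord.
    by apply: (run_call2 (u1 := enc_ord R i) (u2 := enc_set R D)) => //; exact: run_mem_set.
  exact: (@run_cover tau ((u, a) :: sigma) (D :\ u)).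
Qed.

Lemma run_expand tau sigma v : (size sigma < N)%N ->
  runs (l_expand c m) [:: enc_table tau, enc_part sigma, enc_ord R v & G]
    (encO (expand SS g un a0 (bounded m tau) sigma v)).
Proof.
move=> Hs; rewrite /expand; set D := component _ _ _.
apply: (run_let (u := enc_set R D)).
  by apply: (run_call2 (u1 := enc_part sigma) (u2 := enc_ord R v)) => //; apply: run_component; exact: ltnW.
apply: (run_let (u := enc_part (trim SS sigma D))).
  apply: (run_filter (enc := enc_pair enc_var enc_val)) => //; first exact: ltnW.
  move=> p w _.
  apply: (run_call2 (u1 := enc_set R D) (u2 := enc_ord R p.1)) => //; last exact: run_touch.
  exact: (run_head (v := enc_ord R p.2)).
apply: (run_fold (enc := enc_var) (encA := encO)) => //; first exact: size_enum_le.
move=> u z _; set b := branch _ _ _ _ _ _ _ _.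
apply: (run_let (u := encO b)).
  apply: (run_call4 (u1 := enc_table tau) (u2 := enc_part (trim SS sigma D))
    (u3 := enc_set R D) (u4 := enc_ord R u)) => //.
  apply: run_branch; apply: leq_ltn_trans Hs.
  by rewrite /trim size_filter count_size.
by exists (encO b) => //; case: b.
Qed.

Lemma run_keys l : (l <= m)%N -> runs (l_keys l) G (enc_list enc_part (keys 'I_k 'I_n l)).
Proof.
have size_mono j : (size (keys 'I_k 'I_n j) <= size (keys 'I_k 'I_n j.+1))%N.
  elim: j => [|j IH] //.
  by rewrite (@size_keysS 'I_k 'I_n j) (@size_keysS 'I_k 'I_n j.+1) ltnS leq_mul2l IH orbT.
elim: l => [|l IH] lm; first exact: run_cons.
have size_l : (size (keys 'I_k 'I_n l) <= N)%N.
  apply: leq_trans le_keysN; apply: leq_trans (leq_pmulr _ k_gt0).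
  exact: (@homo_leq _ (fun j => size (keys 'I_k 'I_n j)) (fun a b => (a <= b)%N)
    leqnn (fun y x z => @leq_trans y x z) size_mono _ _ (ltnW lm)).
apply: (run_let (IH (ltnW lm))).
apply: (run_let (u := enc_part [seq (i, a) | i <- enum 'I_k, a <- enum 'I_n])).
  apply: (run_pairs (enc := enc_var) (encY := enc_val)) => //.
  - by rewrite size_enum_ord.
  - by rewrite size_enum_ord.
  by move=> x y w w' _ _; exact: run_cons.
apply: run_cons => //.
apply: (run_pairs (enc := enc_pair enc_var enc_val) (encY := enc_part)) => //.
- by rewrite size_allpairs !size_enum_ord.
by move=> x y w w' _ _; exact: run_cons.
Qed.

Lemma size_keys_le : (size (keys 'I_k 'I_n m) <= N)%N.
Proof. exact: leq_trans (leq_pmulr _ k_gt0) le_keysN. Qed.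

Lemma run_table tau : 
  runs (l_table c m) [:: enc_table tau, enc_list enc_part (keys 'I_k 'I_n m) & G]
    (enc_table (expand SS g un a0 (bounded m tau))).
Proof.
apply: (run_pairs (enc := enc_part) (encY := enc_var) (encZ := enc_entry)) => //.
- exact: size_keys_le.
- by rewrite size_enum_ord.
move=> s i w w' sk _; apply: run_cons; first exact: run_cons.
apply: (run_call3 (u1 := enc_table tau) (u2 := enc_part s) (u3 := enc_ord R i)) => //.
by apply: run_expand; apply: leq_trans le_mN; rewrite ltnS -mem_keys.
Qed.

Lemma run_solve : runs (l_solve c m) G (encO (solve SS g un a0 m k)).
Proof.
apply: (run_let (run_keys (leqnn m))).
apply: (run_let (u := enc_table (table SS g un a0 m k))).
  apply: (run_let (u := enc_table (table SS g un a0 m 0))).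
    apply: (run_pairs (enc := enc_part) (encY := enc_var) (encZ := enc_entry)) => //.
    - exact: size_keys_le.
    - by rewrite size_enum_ord.
    by move=> s i w w' sk _; apply: run_cons => //; exact: run_cons.
  have E r : table SS g un a0 m r =
      iter r (fun tau => expand SS g un a0 (bounded m tau)) (table SS g un a0 m 0).
    by elim: r => //= r ->.
  rewrite (E k); apply: (run_iter (encA := enc_table)) => // tau.
  apply: (run_call2 (u1 := enc_table tau) (u2 := enc_list enc_part (keys 'I_k 'I_n m))) => //.
  exact: run_table.
rewrite /solve; set cp := cover_product _ _ _ _; set l := local_product _ _ _ _ _.
apply: (run_call2 (u1 := encO (Some l)) (u2 := encO cp.2)); last exact: run_lift2.
  apply: run_cons => //.
  apply: (run_call2 (u1 := enc_set R (set0 : {set 'I_k})) (u2 := enc_part [::])) => //.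
    exact: enc_set0.
  exact: run_local.
apply: (run_tail (u := enc_set R cp.1)).
apply: (run_call3 (u1 := enc_table (table SS g un a0 m k)) (u2 := enc_part [::])
  (u3 := enc_set R [set: 'I_k])) => //.
  by rewrite enc_setE enum_setT -enumT.
exact: run_cover.
Qed.

End Correctness.

(** * From the program to a polynomial-time oracle *)
Definition l_iota := LFold (LVar 0) LNil (LCons LNil (l_map (LVar 0) (LCons LNil (LVar 1)))).

Definition l_with_globals h :=
  l_call 1 h
    [:: l_head (l_tail (LVar 0)); l_call 0 l_iota [:: l_head (l_tail (LVar 0))];
        l_call 0 l_iota [:: l_head (LVar 0)];
        l_head (l_tail (l_tail (LVar 0))); l_head (l_tail (l_tail (l_tail (LVar 0))))].

(** Arguments: a column, a row; [h] computes the list of columns. *)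
Definition l_entry h := l_call 0 l_nth [:: LVar 1; l_call 0 l_nth [:: LVar 0; h]].

(** In this order: the assignments, with one entry more than the keys; the
    values; the variables; the scopes; the pairs of a variable and a value; the
    table; the cost of a query. *)
Definition size_bound (w : nat) (q : nat -> nat -> nat) (n k : nat) : nat :=
  (w.+2 + n + k + k.+1 ^ w.+1 + k * n + (k * n).+1 ^ w.+1 * k + q n k)%N.

Lemma size_bound_n w q n k : (n <= size_bound w q n k)%N.
Proof. by rewrite /size_bound; lia. Qed.

Lemma size_bound_k w q n k : (k <= size_bound w q n k)%N.
Proof. by rewrite /size_bound; lia. Qed.

Lemma size_bound_poly w q : poly_bounded q -> poly_bounded (size_bound w q).
Proof.
move=> Hq; have Hn := poly_bounded_fst; have Hk := poly_bounded_snd.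
have HS f : poly_bounded f -> poly_bounded (fun n k => (f n k).+1).
  move=> Hf; have [a [d H]] := poly_boundedD Hf (poly_bounded_const 1).
  by exists a, d => n k; rewrite -addn1.
have HkS := poly_bounded_exp w.+1 (HS _ Hk).
have Hkn := poly_boundedM Hk Hn.
have Hkeys := poly_boundedM (poly_bounded_exp w.+1 (HS _ Hkn)) Hk.
do 5!apply: (poly_boundedD _) => //.
exact: poly_boundedD (poly_bounded_const _) Hn.
Qed.

Lemma run_iota (R : realType) explog (query : value R -> value R -> nat -> Prop) N m env :
  (m <= N)%N ->
  runs explog query N l_iota (enc_nat R m :: env) (enc_list (@enc_ord R m) (enum 'I_m)).
Proof.
move=> Hm.
have -> : enc_list (@enc_ord R m) (enum 'I_m) = enc_list (enc_nat R) (iota 0 m).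
  by rewrite /enc_list -val_enum_ord -map_comp.
apply: (run_iter_seq (u := fun r => enc_list (enc_nat R) (iota 0 r))) => // r rm.
have -> : iota 0 r.+1 = 0%N :: map S (iota 0 r) by rewrite /= -(iotaDl 1 0).
apply: run_cons => //.
apply: (run_map (enc := enc_nat R) (encY := enc_nat R)) => //.
  by rewrite size_iota (leq_trans (ltnW rm)).
by move=> i v _; exact: run_cons.
Qed.

Lemma run_globals (R : realType) explog (query : value R -> value R -> nat -> Prop) N
    n k (SS : {set {set 'I_k}}) (arg : value R) h v : (n <= N)%N -> (k <= N)%N ->
  runs explog query N h (globals n SS arg) v ->
  runs explog query N (l_with_globals h) [:: enc_seq [:: enc_nat R n; enc_nat R k;
    enc_seq [seq enc_set R X | X <- enum SS]; arg]] v.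
Proof.
move=> nN kN Hh; set u := enc_seq _.
have H0 : runs explog query N (LVar 0) [:: u] u by [].
have H1 := run_tail H0; have H2 := run_tail H1; have H3 := run_tail H2.
apply: (run_call (vals := globals n SS arg)) => //.
do 5?[case=> [_|] /=].
- exact: run_head H1.
- by apply: (run_call1 (run_head H1)); exact: run_iota.
- by apply: (run_call1 (run_head H0)); exact: run_iota.
- exact: run_head H2.
- exact: run_head H3.
- by [].
Qed.

(** The elements of [S] are enumerated in the same order as a subtype and as a
    set, so that the program can build the argument of a query from a list. *)
Lemma enc_index_restrict (R : realType) n k (S : {set 'I_k}) (x : {ffun 'I_k -> 'I_n}) :
  enc_index R (restrict_index S x) = enc_seq [seq enc_nat R (x i) | i <- enum S].
Proof.
rewrite /enc_index; congr enc_seq.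
have -> : enum S = map val (enum {: {i : 'I_k | i \in S}}).
  rewrite [in RHS]enumT [Finite.enum]unlock /= pmap_filter; last exact: insubK.
  by apply: eq_filter => i; rewrite /= isSome_insub.
by rewrite -map_comp; apply: eq_map => i /=; rewrite ffunE.
Qed.

Lemma poly_time_of_loop (R : realType) explog (P : problem R) w q h :
  poly_bounded q ->
  (forall (n k : nat) (C : tensor R n k) (F : factorization R n k)
        (tau : forall S : {set 'I_k}, {ffun {i : 'I_k | i \in S} -> 'I_n} -> nat)
        (a : arg P n k),
      (0 < n)%N -> (0 < k)%N -> graphical_structure C F w ->
      (forall S x, S \in scopes F -> (tau S x <= q n k)%N) ->
      arg_ok a ->
      exists2 v, runs explog (factor_query F tau) (size_bound w q n k) h
         (globals n (scopes F) (enc_arg a)) v & answer C a v) ->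
  poly_time_on_treewidth explog P w q.
Proof.
move=> Hq H; exists (program_of (l_with_globals h)).
exists (fun n k => cost (l_with_globals h) (size_bound w q n k) + 6)%N; split.
  apply: poly_boundedD; last exact: poly_bounded_const.
  exact/cost_poly/size_bound_poly.
move=> n k C F tau a n0 k0 HC Ht Ha.
have [v Hv Av] := H n k C F tau a n0 k0 HC Ht Ha.
have [c Hc Lc] := program_of_correct
  (run_globals (size_bound_n w q n k) (size_bound_k w q n k) Hv).
by exists v, c.
Qed.

Lemma run_entry (R : realType) explog (query : value R -> value R -> nat -> Prop) N
    n k X (enc : X -> value R) (p : 'M[X]_(n, k)) h (u : 'I_k) (a : 'I_n) env :
  (n <= N)%N -> (k <= N)%N ->
  runs explog query N h [:: enc_ord R u, enc_ord R a & env] (enc_matrix enc p) ->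
  runs explog query N (l_entry h) [:: enc_ord R u, enc_ord R a & env] (enc (p a u)).
Proof.
move=> le_nN le_kN Hh; pose col (i : 'I_k) := enc_list (fun j => enc (p j i)) (enum 'I_n).
apply: (run_call2 (u1 := enc_ord R a) (u2 := col u)) => //.
  apply: (run_call2 (u1 := enc_ord R u) (u2 := enc_list col (enum 'I_k))) => //.
  have := @run_nth R explog query N _ col u u (enum 'I_k).
  rewrite nth_ord_enum; apply; last by rewrite size_enum_ord.
  exact: leq_trans (ltnW (ltn_ord u)) le_kN.
have := @run_nth R explog query N _ (fun j => enc (p j u)) a a (enum 'I_n).
rewrite nth_ord_enum; apply; last by rewrite size_enum_ord.
exact: leq_trans (ltnW (ltn_ord a)) le_nN.
Qed.

Lemma bag_size (k w : nat) (SS : {set {set 'I_k}}) (J : junction_tree (scope_graph SS)) t :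
  jt_width J = w -> (#|jt_bag (j := J) t| <= w.+1)%N.
Proof.
rewrite /jt_width => Hw; apply: leq_trans (leq_bigmax (F := fun u => #|jt_bag (j := J) u|) t) _.
by rewrite -Hw leqSpred.
Qed.

(** The two halves meet: the elimination is known to succeed by the junction
    tree, and to be correct whenever it succeeds. *)
Section Oracle.
Context (R : realType) (explog : bool) (w : nat) (q : nat -> nat -> nat).
Context (n k : nat) (C : tensor R n k) (F : factorization R n k).
Context (tau : forall S : {set 'I_k}, {ffun {i : 'I_k | i \in S} -> 'I_n} -> nat).
Arguments tau : clear implicits.
Hypothesis n_gt0 : (0 < n)%N.
Hypothesis k_gt0 : (0 < k)%N.
Hypothesis C_graphical : graphical_structure C F w.
Hypothesis tau_le : forall S x, S \in scopes F -> (tau S x <= q n k)%N.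

Notation N := (size_bound w q n k).
Notation runs := (runs explog (factor_query F tau) N).

Context (K : comPzSemiRingType) (encK : K -> value R) (c : semiring_code).
Context (gw : R -> K) (un : 'I_k -> 'I_n -> K) (arg : value R).
Notation G := (globals n (scopes F) arg).

Hypothesis run_zero : forall env, runs (code_zero c) env (encK 0).
Hypothesis run_one : forall env, runs (code_one c) env (encK 1).
Hypothesis run_add : forall x y env,
  runs (code_add c) [:: encK x, encK y & env] (encK (x + y)).
Hypothesis run_mul : forall x y env,
  runs (code_mul c) [:: encK x, encK y & env] (encK (x * y)).
Hypothesis run_unary : forall u a,
  runs (code_unary c) [:: enc_ord R u, enc_ord R a & G] (encK (un u a)).
Hypothesis run_factor : forall r : R, runs (code_factor c) (VReal r :: G) (encK (gw r)).

Lemma run_oracle : runs (l_head (l_solve c w.+1)) G (encK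
  (\sum_(x : {ffun 'I_k -> 'I_n})
     (\prod_(T in scopes F) gw (summand F T (restrict_index T x))) *
     \prod_i un i (x i))).
Proof.
have [_ [[J Jw] _]] := C_graphical.
have bagle t := bag_size t Jw.
pose f T (x : {ffun 'I_k -> 'I_n}) := summand F T (restrict_index T x).
(* unassigned variables read as 0, which is what [l_val] returns by default *)
pose a0 := Ordinal n_gt0.
have f_local T : depends (fun x => gw (f T x)) T.
  move=> x y Hxy; rewrite /f; congr (gw (summand F T _)).
  by apply/ffunP => i; rewrite !ffunE; apply: Hxy; exact: (valP i).
have some := @solve_some k (scopes F) J 'I_n K (fun T x => gw (f T x)) un a0 w.+1 bagle.
have sol := @solve_sound _ _ K (scopes F) (fun T x => gw (f T x)) un a0 f_local w.+1 k.
case E: (solve _ _ _ _ _ _) some sol => [z|] // _ /(_ z erefl) zE.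
rewrite -[X in runs _ _ (encK X)]zE.
have size_scopes := card_scopes bagle.
have size_k := size_keys 'I_k 'I_n w.+1; rewrite !card_ord in size_k.
have /leq_mul /(_ (leqnn k)) size_kk := size_k.
apply: (run_head (v := VNil)); rewrite -[VCons _ _]/(enc_option encK (Some z)) -E.
apply: (run_solve (f := f) (a0 := a0)) => //; try (by rewrite /size_bound; lia).
move=> T x TS; exists (tau T (restrict_index T x)).
  by rewrite -enc_index_restrict; exact: FactorQuery.
by apply: leq_trans (tau_le _ TS) _; rewrite /size_bound; lia.
Qed.

End Oracle.

(** * The minimum: the tropical semiring *)
Section Tropical.
Context (R : realType).

(** [None] is [+oo].  It is needed as the zero of the semiring only: the minimum
    over a nonempty set of reals is a real. *)
Definition tropical : Type := option R.

HB.instance Definition _ := Choice.copy tropical (option R).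

Definition trop_add (x y : tropical) : tropical :=
  if x is Some a then if y is Some b then Some (Num.min a b) else x else y.

Definition trop_mul (x y : tropical) : tropical :=
  if x is Some a then if y is Some b then Some (a + b) else None else None.

Fact trop_addA : associative trop_add.
Proof. by move=> [a|] [b|] [c|] //=; rewrite minA. Qed.

Fact trop_addC : commutative trop_add.
Proof. by move=> [a|] [b|] //=; rewrite minC. Qed.

Fact trop_add0 : left_id None trop_add.
Proof. by case. Qed.

HB.instance Definition _ := GRing.isNmodule.Build tropical trop_addA trop_addC trop_add0.

Fact trop_mulA : associative trop_mul.
Proof. by move=> [a|] [b|] [c|] //=; rewrite addrA. Qed.

Fact trop_mulC : commutative trop_mul.
Proof. by move=> [a|] [b|] //=; rewrite addrC. Qed.

Fact trop_mul1 : left_id (Some 0) trop_mul.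
Proof. by move=> [a|] //=; rewrite add0r. Qed.

Fact trop_mulDl : left_distributive trop_mul trop_add.
Proof. by move=> [a|] [b|] [c|] //=; rewrite addr_minl. Qed.

Fact trop_mul0 : left_zero None trop_mul.
Proof. by []. Qed.

HB.instance Definition _ := GRing.Nmodule_isComPzSemiRing.Build tropical
  trop_mulA trop_mulC trop_mul1 trop_mulDl trop_mul0.

Definition ereal_of_tropical (x : tropical) : \bar R :=
  if x is Some a then a%:E else +oo%E.

Lemma ereal_of_tropical_sum (I : finType) (a : I -> tropical) :
  ereal_of_tropical (\sum_i a i) = \big[Order.min/+oo%E]_i ereal_of_tropical (a i).
Proof.
apply: (big_morph ereal_of_tropical) => // -[x|] [y|] //=.
- by rewrite EFin_min.
- by rewrite miney.
Qed.

Lemma prod_tropical (I : Type) (r : seq I) (P : pred I) (a : I -> R) :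
  \prod_(i <- r | P i) (Some (a i) : tropical) = Some (\sum_(i <- r | P i) a i).
Proof. by apply/esym/(big_morph (fun x => Some x : tropical)). Qed.

End Tropical.

(** The expression [p] finds the matrix of the oracle among the globals. *)
Definition tropical_code (p : loop) : semiring_code := {|
  code_zero := LNil;
  code_one := l_some LZero;
  code_add := LIf (LVar 0)
    (LIf (LVar 1)
      (LIfLe (l_head (LVar 0)) (l_head (LVar 1)) (LVar 0) (LVar 1)) (LVar 0))
    (LVar 1);
  code_mul := l_lift2 (LBinop Add (LVar 0) (LVar 1));
  code_unary :=
    l_some (LUnop Opp (l_entry p));
  code_factor := l_some (LVar 0)
|}.

Definition l_min w p := l_head (l_head (l_solve (tropical_code p) w.+1)).

Lemma run_min (R : realType) (w : nat) (q : nat -> nat -> nat)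
  (n k : nat) (C : tensor R n k) (F : factorization R n k)
  (tau : forall S : {set 'I_k}, {ffun {i : 'I_k | i \in S} -> 'I_n} -> nat)
  (p : 'M[R]_(n, k)) (arg : value R) hp :
  (0 < n)%N -> (0 < k)%N -> graphical_structure C F w ->
  (forall S x, S \in scopes F -> (tau S x <= q n k)%N) ->
  (forall u a : value R, runs false (factor_query F tau) (size_bound w q n k) hp
    [:: u, a & globals n (scopes F) arg] (enc_matrix (@VReal R) p)) ->
  exists2 r : R, runs false (factor_query F tau) (size_bound w q n k) (l_min w hp)
    (globals n (scopes F) arg) (VReal r) & r%:E = MIN C p.
Proof.
move=> n0 k0 HC Ht Hp.
have := @run_oracle R false w q n k C F tau n0 k0 HC Ht (tropical R)
  (enc_option (@VReal R)) (tropical_code hp) (fun r => Some r) (fun i a => Some (- p a i)) arg.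
set s := \sum_x _ => Hrun.
have sE : ereal_of_tropical s = MIN C p.
  rewrite ereal_of_tropical_sum /MIN; apply: eq_bigr => x _.
  rewrite !prod_tropical /= (HC.1 x) sumrN; congr (_ - _)%:E.
have {}Hrun : runs false (factor_query F tau) (size_bound w q n k)
    (l_head (l_solve (tropical_code hp) w.+1)) (globals n (scopes F) arg)
    (enc_option (@VReal R) s).
  apply: Hrun => //.
  - by move=> env; apply: run_cons.
  - move=> x y env; exists (enc_option (@VReal R) x) => //; case: x => [a|] //=.
    exists (enc_option (@VReal R) y) => //; case: y => [b|] //=.
    exists a, b; split.
    + exact: (run_head (v := VNil)).
    + exact: (run_head (v := VNil)).
    by case: ifP => ab; rewrite minEle ab.
  - move=> x y env; apply: (run_lift2 (opK := fun a b => a + b)) => a b env'.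
    by exists a, b, (a + b).
  - move=> u a; apply: run_cons => //.
    exists (p a u), (- p a u); split=> //.
    by apply: run_entry; [exact: size_bound_n | exact: size_bound_k | exact: Hp].
  - by move=> r; apply: run_cons.
case sS : s sE Hrun => [r|] sE Hrun; first by exists r => //; exact: run_head Hrun.
(* [n] is positive: some assignment exists, and its cost bounds the minimum *)
pose j0 : {ffun 'I_k -> 'I_n} := [ffun=> Ordinal n0].
have : (MIN C p <= (C j0 - \sum_(i < k) p (j0 i) i)%:E)%E.
  by rewrite /MIN (bigD1 j0) //= ge_min lexx.
by rewrite -sE.
Qed.

(** * The soft minimum: sums of exponentials *)

(** The argument of the oracle is the pair of the matrix and [eta]; an entry
    [-oo] of the matrix is encoded as [VNil] and has weight 0. *)
Definition gibbs_code : semiring_code := {|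
  code_zero := LZero;
  code_one := LOne;
  code_add := LBinop Add (LVar 0) (LVar 1);
  code_mul := LBinop Mul (LVar 0) (LVar 1);
  code_unary := LMatch
    (l_entry (l_head (LVar 6)))
    LZero
    (LUnop Exp (LBinop Mul (l_tail (LVar 8)) (LVar 0)));
  code_factor :=
    LUnop Exp (LUnop Opp (LBinop Mul (l_tail (LVar 5)) (LVar 0)))
|}.

(** The sum is never negative; if it vanishes, its logarithm is [-oo], and the
    answer is [+oo]. *)
Definition l_softmin w :=
  LLet (l_head (l_solve gibbs_code w.+1))
    (LIfLe (LVar 0) LZero (LCons LNil LNil)
      (LCons (LUnop Opp (LBinop Div (LUnop Log (LVar 0)) (l_tail (LVar 5)))) LNil)).

Definition gibbs_weight (R : realType) (eta : R) (x : \bar R) : R :=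
  if x is r%:E then expR (eta * r) else 0.

(** If some [x i] is [-oo], both sides vanish; otherwise all terms are real and
    this is the functional equation of the exponential. *)
Lemma gibbs_factorization (R : realType) (I : finType) (c eta : R) (x : I -> \bar R) :
  0 < eta -> (forall i, x i != +oo%E) ->
  expeR (- (eta%:E * (c%:E - \sum_i x i)))%E =
    (expR (- (eta * c)) * \prod_i gibbs_weight eta (x i))%:E.
Proof.
move=> eta0 xy; have [/existsP [i0 /eqP xi0]|] := boolP [exists i, x i == -oo%E].
  have -> : (\sum_i x i = -oo)%E.
    by apply/eqP; rewrite esum_eqNy; apply/existsP; exists i0; rewrite xi0.
  by rewrite /= gt0_muley ?lte_fin //= (bigD1 i0) //= xi0 /= mul0r mulr0.
rewrite negb_exists => /forallP xN.
pose r i := fine (x i).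
have xr i : x i = (r i)%:E by rewrite /r fineK // fin_numE xN xy.
have -> : \prod_i gibbs_weight eta (x i) = expR (eta * \sum_i r i).
  rewrite mulr_sumr (big_morph expR (@expRD R) (@expR0 R)).
  by apply: eq_bigr => i _; rewrite xr.
have -> : (\sum_i x i = (\sum_i r i)%:E)%E.
  by rewrite -sumEFin; apply: eq_bigr => i _.
rewrite -EFinB -EFinM -EFinN /= -expRD; congr (expR _)%:E; ring.
Qed.

Lemma run_softmin (R : realType) (w : nat) (q : nat -> nat -> nat)
  (n k : nat) (C : tensor R n k) (F : factorization R n k)
  (tau : forall S : {set 'I_k}, {ffun {i : 'I_k | i \in S} -> 'I_n} -> nat)
  (p : 'M[\bar R]_(n, k)) (eta : R) :
  (0 < n)%N -> (0 < k)%N -> graphical_structure C F w ->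
  (forall S x, S \in scopes F -> (tau S x <= q n k)%N) ->
  (forall j i, p j i != +oo%E) -> 0 < eta ->
  runs true (factor_query F tau) (size_bound w q n k) (l_softmin w)
    (globals n (scopes F) (VCons (enc_matrix (@enc_ereal R) p) (VReal eta)))
    (enc_ereal (SMIN C p eta)).
Proof.
move=> n0 k0 HC Ht py eta0.
set arg := VCons _ _; set G := globals _ _ _.
have := @run_oracle R true w q n k C F tau n0 k0 HC Ht R
  (@VReal R) gibbs_code (fun r => expR (- (eta * r)))
  (fun i a => gibbs_weight eta (p a i)) arg.
set s := \sum_x _ => Hrun.
have sE : s%:E = (\sum_(j : {ffun 'I_k -> 'I_n})
   expeR (- (eta%:E * ((C j)%:E - \sum_(i < k) p (j i) i))))%E.
  rewrite -sumEFin; apply: eq_bigr => x _; rewrite gibbs_factorization //.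
  congr (_ * _)%:E; rewrite (HC.1 x) mulr_sumr -sumrN.
  by rewrite (big_morph expR (@expRD R) (@expR0 R)).
have run_eta env' i : onth env' i = Some arg ->
    runs true (factor_query F tau) (size_bound w q n k) (l_tail (LVar i)) env' (VReal eta).
  by move=> Hi; apply: (run_tail (u := enc_matrix (@enc_ereal R) p)).
have {}Hrun : runs true (factor_query F tau) (size_bound w q n k)
    (l_head (l_solve gibbs_code w.+1)) G (VReal s).
  apply: Hrun => //.
  - by move=> x y env; exists x, y, (x + y).
  - by move=> x y env; exists x, y, (x * y).
  - move=> u a; exists (enc_ereal (p a u)).
      apply: run_entry; [exact: size_bound_n | exact: size_bound_k |].
      exact: (run_head (v := VReal eta)).
    case: (p a u) (py a u) => [r|//|] _ //=.
    exists (eta * r), (expR (eta * r)); split=> //.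
    by exists eta, r, (eta * r); split=> //; exact: run_eta.
  - move=> r; exists (- (eta * r)), (expR (- (eta * r))); split=> //.
    exists (eta * r), (- (eta * r)); split=> //.
    by exists eta, r, (eta * r); split=> //; exact: run_eta.
apply: (run_let Hrun); rewrite /SMIN -sE.
exists s, 0; split=> //; case: ifPn => s0.
  rewrite le0_lneNy ?lee_fin // gt0_muleNy ?lte_fin ?invr_gt0 //.
  exact: run_true.
rewrite -ltNge in s0.
rewrite lne_EFin // -EFinM -EFinN.
apply: run_cons => //.
exists (ln s / eta), (- (ln s / eta)); split=> //.
  exists (ln s), eta, (ln s / eta); split=> //.
  - by exists s, (ln s); rewrite /= s0.
  - exact: run_eta.
  - by rewrite /= gt_eqF.
by rewrite mulrC.
Qed.

Theorem theorem5p5 (R : realType) (w : nat) (q : nat -> nat -> nat)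
  (q_poly : poly_bounded q) :
  [/\ poly_time_on_treewidth false (MIN_problem R) w q,
      poly_time_on_treewidth false (AMIN_problem R) w q
    & poly_time_on_treewidth true (SMIN_problem R) w q].
Proof.
split.
- apply: (@poly_time_of_loop R false (MIN_problem R) w q (l_min w (LVar 6))) => //.
  move=> n k C F tau p n0 k0 HC Ht _.
  have [u a|r Hr rE] := run_min (p := p) (hp := LVar 6)
    (arg := enc_arg (p := MIN_problem R) p) n0 k0 HC Ht; first by [].
  by exists (VReal r) => //; exists r.
- apply: (@poly_time_of_loop R false (AMIN_problem R) w q (l_min w (l_head (LVar 6)))) => //.
  move=> n k C F tau [p eps] n0 k0 HC Ht eps0.
  have [u a|r Hr rE] := run_min (p := p) (hp := l_head (LVar 6))
    (arg := enc_arg (p := AMIN_problem R) (p, eps)) n0 k0 HC Ht.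
    exact: (run_head (v := VReal eps)).
  exists (VReal r) => //; exists r => //=.
  by rewrite -rE -EFinB subrr abse0 lee_fin ltW.
- apply: (@poly_time_of_loop R true (SMIN_problem R) w q (l_softmin w)) => //.
  move=> n k C F tau [p eta] n0 k0 HC Ht [py eta0].
  exists (enc_ereal (SMIN C p eta)) => //.
  exact: run_softmin.
Qed.
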